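(* Let $\mathscr A$ be a $W^*$-algebra and let $\mathscr E$ be a self-dual Hilbert $\mathscr A$-module. Let $\mathscr L$ be a (norm-)closed submodule of $\mathscr E$ such that $\mathscr E\setminus\mathscr L$ has nonempty interior with respect to the weak$^*$-topology on $\mathscr E$. Then there exists a normal state $\omega$ on $\mathscr A$ such that $\iota_\omega(\mathscr L)$ is not dense in $\mathscr E_\omega$. In particular, $\iota_\omega(\mathscr L)^\perp\neq\{0\}$, where the orthogonal complement is taken in the Hilbert space $\mathscr E_\omega$.
   Context: For a positive linear functional $\omega$ on $\mathscr A$, put $\mathscr N_\omega=\{x\in\mathscr E:\omega(\langle x,x\rangle)=0\}$, a closed subspace of $\mathscr E$. The quotient $\mathscr E/\mathscr N_\omega$ carries the inner product $(x+\mathscr N_\omega,y+\mathscr N_\omega)_\omega:=\omega(\langle x,y\rangle)$; $\mathscr E_\omega$ denotes its Hilbert space completion, and $\iota_\omega:\mathscr E\to\mathscr E_\omega$ is the map $\iota_\omega(x)=x+\mathscr N_\omega$. $\mathscr E$ is self-dual if every bounded $\mathscr A$-linear map $\tau:\mathscr E\to\mathscr A$ is of the form $\tau(y)=\langle x,y\rangle$ $(y\in\mathscr E)$ for some $x\in\mathscr E$ (inner product $\mathscr A$-linear in the second variable). Let $\mathscr A_*$ be the predual of $\mathscr A$. A self-dual Hilbert module $\mathscr E$ over a $W^*$-algebra is a dual Banach space (Paschke), and the weak$^*$-topology on $\mathscr E$ is the one coming from this duality. Its predual is obtained from the projective tensor product of $\mathscr A_*$ with the conjugate space of $\mathscr E$;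 concretely, the weak$^*$-topology on $\mathscr E$ is the coarsest topology making all maps $x\mapsto\sum_{j=1}^\infty\lambda_j\tau_j(\langle x,y_j\rangle)$ continuous, where $\lambda_j>0$, $\sum_{j=1}^\infty\lambda_j<\infty$, $\tau_j\in\mathscr A_*$, $y_j\in\mathscr E$ and $\|\tau_j\|=\|y_j\|=1$. *)

(* Defs.v *)
From HB Require Import structures.
From mathcomp Require Import all_boot all_order all_algebra.
From mathcomp Require Import boolp classical_sets functions interval_inference.
From mathcomp Require Import reals topology normedtype sequences.
From mathcomp Require Import generic_quotient ring_quotient complex ring lra.

Set Implicit Arguments.
Unset Strict Implicit.
Unset Printing Implicit Defensive.

Import Order.TTheory GRing.Theory Num.Theory.
Import numFieldNormedType.Exports.

Local Open Scope classical_set_scope.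
Local Open Scope ring_scope.
Local Open Scope complex_scope.

(* Forms are conjugate linear in the first variable and linear in the second. *)
Record semi_inner (R : realType) (V : lmodType R[i]) := SemiInner {
  form :> V -> V -> R[i];
  formDZr : forall (c : R[i]) (x y z : V),
    form x (c *: y + z) = c * form x y + form x z;
  form_conj : forall x y : V, conjc (form x y) = form y x;
  form_ge0 : forall x : V, 0 <= form x x }.

Section SemiInnerTheory.
Variables (R : realType) (V : lmodType R[i]) (s : semi_inner V).
Local Notation C := R[i].
Implicit Types (x y z : V) (c : C).

Lemma form0r x : s x 0 = 0.
Proof.
have := formDZr s 1 x 0 0; rewrite scale1r addr0 mul1r => /eqP.
by rewrite -subr_eq subrr => /eqP.
Qed.

Lemma formZr c x y : s x (c *: y) = c * s x y.
Proof. by have := formDZr s c x y 0; rewrite addr0 form0r addr0. Qed.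

Lemma formDr x y z : s x (y + z) = s x y + s x z.
Proof. by have := formDZr s 1 x y z; rewrite scale1r mul1r. Qed.

Lemma formNr x y : s x (- y) = - s x y.
Proof. by rewrite -scaleN1r formZr mulN1r. Qed.

Lemma formBr x y z : s x (y - z) = s x y - s x z.
Proof. by rewrite formDr formNr. Qed.

Lemma formDl x y z : s (x + y) z = s x z + s y z.
Proof. by rewrite -form_conj formDr rmorphD/= !form_conj. Qed.

Lemma formZl c x y : s (c *: x) y = conjc c * s x y.
Proof. by rewrite -form_conj formZr rmorphM/= form_conj. Qed.

Lemma form0l x : s 0 x = 0.
Proof. by rewrite -form_conj form0r rmorph0. Qed.

Lemma formNl x y : s (- x) y = - s x y.
Proof. by rewrite -form_conj formNr rmorphN/= form_conj. Qed.

Lemma formBl x y z : s (x - y) z = s x z - s y z.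
Proof. by rewrite formDl formNl. Qed.

Lemma conjc_nneg c : 0 <= c -> conjc c = c.
Proof. by case: c => a b /=; rewrite lecE/= => /andP[/eqP -> _]; rewrite oppr0. Qed.

Lemma form_cauchy_schwarz x y : `|s x y| ^+ 2 <= s x x * s y y.
Proof.
have a0 := form_ge0 s x; have b0 := form_ge0 s y.
have E (t : C) : conjc t = t ->
    0 <= s x x - t *+ 2 * `|s x y| ^+ 2 + t ^+ 2 * `|s x y| ^+ 2 * s y y.
  move=> tr; have := form_ge0 s (x - (t * s y x) *: y).
  rewrite formBl !formBr !formZl !formZr rmorphM/= tr form_conj sqr_normc.
  rewrite form_conj; congr (0 <= _).
  by ring.
have [b_eq0|b_neq0] := eqVneq (s y y) 0.
  rewrite b_eq0 mulr0 in E *.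
  have [->//|n0] := eqVneq (`|s x y| ^+ 2) 0.
  have n_gt0 : 0 < `|s x y| ^+ 2 by rewrite lt_neqAle eq_sym n0 exprn_ge0.
  have := E ((s x x + 1) / `|s x y| ^+ 2).
  rewrite mulr0 addr0 conjc_nneg; last by rewrite divr_ge0 ?exprn_ge0 ?addr_ge0.
  move=> /(_ erefl); rewrite mulrnAl divfK// mulr2n opprD.
  have -> : s x x + (- (s x x + 1) - (s x x + 1)) = - (s x x + 2%:R) by ring.
  rewrite oppr_ge0 => /le_gtF; rewrite ltr_wpDl// ?ltr0n//.
have b_gt0 : 0 < s y y by rewrite lt_neqAle eq_sym b_neq0.
have := E (s y y)^-1; rewrite conjc_nneg ?invr_ge0// => /(_ erefl).
have -> : s x x - (s y y)^-1 *+ 2 * `|s x y| ^+ 2 +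
    (s y y)^-1 ^+ 2 * `|s x y| ^+ 2 * s y y
  = s x x - `|s x y| ^+ 2 / s y y by field.
by rewrite subr_ge0 ler_pdivrMr.
Qed.

Definition seminorm x : C := sqrtC (s x x).

Lemma seminorm_ge0 x : 0 <= seminorm x.
Proof. by rewrite sqrtC_ge0 form_ge0. Qed.

Lemma seminorm_sqr x : seminorm x ^+ 2 = s x x.
Proof. exact: sqrtCK. Qed.

Lemma le_form_seminorm x y : `|s x y| <= seminorm x * seminorm y.
Proof.
rewrite -(@ler_pXn2r _ 2)// ?nnegrE ?mulr_ge0 ?seminorm_ge0//.
by rewrite exprMn !seminorm_sqr form_cauchy_schwarz.
Qed.

Lemma seminormD x y : seminorm (x + y) <= seminorm x + seminorm y.
Proof.
rewrite -(@ler_pXn2r _ 2)// ?nnegrE ?addr_ge0 ?seminorm_ge0//.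
rewrite sqrrD !seminorm_sqr formDl !formDr.
have -> : s x x + s x y + (s y x + s y y) = s x x + (s x y + s y x) + s y y by ring.
rewrite lerD2r lerD2l.
have : s x y + s y x <= `|s x y + s y x|.
  apply: real_ler_norm; rewrite -(form_conj s x y).
  by case: (s x y) => a b; rewrite complex_real/= addrN eqxx.
move=> /le_trans; apply; apply: le_trans (ler_normD _ _) _.
by rewrite mulr2n lerD ?le_form_seminorm// mulrC le_form_seminorm.
Qed.

Lemma seminormZ c x : seminorm (c *: x) = `|c| * seminorm x.
Proof.
apply/eqP; rewrite -(@eqrXn2 _ 2)// ?mulr_ge0 ?seminorm_ge0//.
by rewrite exprMn !seminorm_sqr formZl formZr sqr_normc mulrA [_ * c]mulrC.
Qed.

Lemma seminorm0 : seminorm 0 = 0.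
Proof. by rewrite -(scale0r 0) seminormZ normr0 mul0r. Qed.

Lemma seminormN x : seminorm (- x) = seminorm x.
Proof. by rewrite -scaleN1r seminormZ normrN1 mul1r. Qed.

Lemma seminormB x y : seminorm (x - y) = seminorm (y - x).
Proof. by rewrite -opprB seminormN. Qed.

End SemiInnerTheory.

Section ComplexComplete.
Variable R : realType.
Local Notation C := R[i].

Lemma complex_cauchy_cvg (u : nat -> C^o) :
  (forall e : C, 0 < e ->
    exists N, forall m n, (N <= m)%N -> (N <= n)%N -> `|u m - u n| < e) ->
  cvgn u.
Proof.
move=> uC.
have cvg_part (f : C -> R) : (forall a b : C, f (a - b) = f a - f b) ->
    (forall a : C, `|f a| <= complex.Re `|a|) ->
    exists l : R, (fun n => f (u n)) @ \oo --> l.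
  move=> fB fle.
  suff /cauchy_cvgP/cvg_ex[l ul] : cauchy ((fun n => f (u n)) @ \oo) by exists l.
  apply/cauchy_ballP => e e0.
  have [|N uN] := uC e%:C; first by rewrite ltcR.
  exists ([set f (u n) | n in [set n | (N <= n)%N]], [set f (u n) | n in [set n | (N <= n)%N]]).
    by split; exists N => // n /= Nn; exists n.
  move=> [_ _] [[m /= Nm <-] [n /= Nn <-]] /=.
  rewrite /ball/= -fB; apply: le_lt_trans (fle _) _.
  by have := uN _ _ Nm Nn; rewrite normc_def ltcR.
have [a ua] : exists l : R, (fun n => complex.Re (u n)) @ \oo --> l.
  apply: cvg_part => [[a b] [c d]//|[a b]].
  by rewrite normc_def/= -sqrtr_sqr ler_sqrt ?addr_ge0 ?sqr_ge0// lerDl sqr_ge0.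
have [b ub] : exists l : R, (fun n => complex.Im (u n)) @ \oo --> l.
  apply: cvg_part => [[x y] [c d]//|[x y]].
  by rewrite normc_def/= -sqrtr_sqr ler_sqrt ?addr_ge0 ?sqr_ge0// lerDr sqr_ge0.
apply/cvg_ex; exists (a +i* b); apply/cvgrPdist_lt => e e0.
have [e' e'0 ee'] : exists2 e' : R, 0 < e' & e'%:C = e.
  by case: e e0 => x y; rewrite ltcE/= => /andP[/eqP -> x0]; exists x.
have h : 0 < e' / 2 by rewrite divr_gt0.
move/cvgrPdist_lt : ua => /(_ _ h) ua; move/cvgrPdist_lt : ub => /(_ _ h) ub.
near=> n.
have ua1 : `|a - complex.Re (u n)| < e' / 2 by near: n.
have ub1 : `|b - complex.Im (u n)| < e' / 2 by near: n.
have -> : a +i* b - u n = (a - complex.Re (u n))%:C + 'i * (b - complex.Im (u n))%:C.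
  by case: (u n) => x y; apply/eqP; rewrite eq_complex/=; apply/andP; split; apply/eqP; ring.
apply: le_lt_trans (ler_normD _ _) _.
rewrite normrM !normc_def/= expr0n/= !addr0 !add0r expr1n sqrtr1 mul1r !sqrtr_sqr.
rewrite -rmorphD/= -ee' ltcR; lra.
Unshelve. all: by end_near. Qed.

Lemma complex_cvg_ge0 (u : nat -> C^o) (l : C) :
  u @ \oo --> (l : C^o) -> (\forall n \near \oo, 0 <= u n) -> 0 <= l.
Proof.
move=> ul u0; have ul' : u @ \oo --> (`|l| : C^o).
  apply: cvg_trans (cvg_norm ul); apply: near_eq_cvg.
  by near=> n; rewrite ger0_norm//; near: n; exact: u0.
by rewrite (cvg_unique _ ul ul').
Unshelve. all: by end_near. Qed.

End ComplexComplete.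

HB.mixin Record hasInner (R : realType) H of CompleteNormedModule R[i] H := {
  dot : H -> H -> R[i];
  dotDZr : forall (c : R[i]) (x y z : H),
    dot x (c *: y + z) = c * dot x y + dot x z;
  dot_conj : forall x y : H, conjc (dot x y) = dot y x;
  dot_norm : forall x : H, dot x x = `|x| ^+ 2 }.

#[short(type="hilbertType")]
HB.structure Definition Hilbert (R : realType) :=
  {H of CompleteNormedModule R[i] H & hasInner R H}.

Definition orthogonal_complement (R : realType) (H : hilbertType R)
  (S : set H) : set H := [set h | forall x, S x -> dot h x = 0].

Section Completion.
Variables (R : realType) (V : lmodType R[i]) (s : semi_inner V).
Local Notation C := R[i].

Definition is_cauchy_seq (u : nat -> V) : Prop := forall e : C, 0 < e ->
  exists N, forall m n, (N <= m)%N -> (N <= n)%N -> seminorm s (u m - u n) < e.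

Definition is_null_seq (u : nat -> V) : Prop := forall e : C, 0 < e ->
  exists N, forall n, (N <= n)%N -> seminorm s (u n) < e.

Definition cauchy_pred : {pred nat -> V} := fun u => `[< is_cauchy_seq u >].

Lemma cauchy_pred_submod : GRing.submod_closed cauchy_pred.
Proof.
split=> [|c u v].
  by apply/asboolP => e e0; exists 0%N => m n _ _; rewrite subrr seminorm0.
move=> /asboolP uC /asboolP vC; apply/asboolP => e e0.
have c0 : 0 < `|c| + 1 by rewrite ltr_wpDl.
have [|N uN] := uC (e / 2 / (`|c| + 1)); first by rewrite !divr_gt0.
have [|M vM] := vC (e / 2); first by rewrite divr_gt0.
exists (maxn N M) => m n; rewrite !geq_max => /andP[Nm Mm] /andP[Nn Mn].
rewrite [X in seminorm s X](_ : _ = c *: (u m - u n) + (v m - v n)); last first.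
  by rewrite /= scalerBr opprD addrACA.
apply: le_lt_trans (seminormD _ _ _) _; rewrite [e]splitr seminormZ.
apply: ler_ltD; last exact: vM.
apply: (@le_trans _ _ ((`|c| + 1) * (e / 2 / (`|c| + 1)))).
  by rewrite ler_pM ?seminorm_ge0 ?lerDl// ltW// uN.
by rewrite mulrC divfK ?gt_eqF.
Qed.

HB.instance Definition _ :=
  GRing.isSubmodClosed.Build C (nat -> V) cauchy_pred cauchy_pred_submod.

Record cauchy_seq := CauchySeq {
  seq_of :> nat -> V; _ : seq_of \in cauchy_pred }.

HB.instance Definition _ := [isSub for seq_of].
HB.instance Definition _ := [Choice of cauchy_seq by <:].
HB.instance Definition _ := [SubChoice_isSubLmodule of cauchy_seq by <:].

Definition null_pred : {pred cauchy_seq} := fun u => `[< is_null_seq u >].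

Lemma null_pred_zmod : GRing.zmod_closed null_pred.
Proof.
split=> [|u v].
  by apply/asboolP => e e0; exists 0%N => n _; rewrite seminorm0.
move=> /asboolP uC /asboolP vC; apply/asboolP => e e0.
have [|N uN] := uC (e / 2); first by rewrite divr_gt0.
have [|M vM] := vC (e / 2); first by rewrite divr_gt0.
exists (maxn N M) => n; rewrite !geq_max => /andP[Nn Mn].
apply: le_lt_trans (seminormD _ _ _) _; rewrite [e]splitr seminormN.
by apply: ltrD; [exact: uN|exact: vM].
Qed.

HB.instance Definition _ :=
  GRing.isZmodClosed.Build cauchy_seq null_pred null_pred_zmod.

(* Cauchy sequences for the seminorm sqrt (s x x), modulo null sequences: the *)
(* Hilbert space completion of the quotient of V by {x | s x x = 0}.          *)
Definition completion : Type := {ideal_quot null_pred}.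

HB.instance Definition _ := GRing.Zmodule.on completion.
HB.instance Definition _ := Quotient.on completion.

Definition cls (u : cauchy_seq) : completion := \pi_(completion)%qT u.


Lemma eq_cls u v : cls u = cls v <-> is_null_seq (u - v : cauchy_seq).
Proof.
split=> [uv|uv].
  by apply/asboolP; rewrite -[`[< _ >]]/(u - v \in null_pred) Quotient.idealrBE; apply/eqP.
by apply/eqP; rewrite -Quotient.idealrBE; apply/asboolP.
Qed.

Lemma cls_repr x : cls (repr x) = x.
Proof. exact: reprK. Qed.

Lemma repr_cls u : is_null_seq (repr (cls u) - u : cauchy_seq).
Proof. by apply/eq_cls; rewrite cls_repr. Qed.

Lemma clsD u v : cls (u + v) = cls u + cls v.
Proof. by rewrite /cls !piE. Qed.

Lemma clsN u : cls (- u) = - cls u.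
Proof. by rewrite /cls !piE. Qed.

Definition cls_scale (c : C) (x : completion) : completion := cls (c *: repr x).

Lemma cls_scaleE c u : cls_scale c (cls u) = cls (c *: u).
Proof.
apply/eq_cls => e e0; have c0 : 0 < `|c| + 1 by rewrite ltr_wpDl.
have [|N uN] := repr_cls u (e := e / (`|c| + 1)); first by rewrite divr_gt0.
exists N => n Nn; rewrite -scalerBr seminormZ.
apply: (@le_lt_trans _ _ ((`|c| + 1) * seminorm s ((repr (cls u) - u) n))).
  by rewrite ler_wpM2r ?seminorm_ge0// lerDl.
by rewrite mulrC -ltr_pdivlMr// uN.
Qed.

Lemma cls_scaleA a b x : cls_scale a (cls_scale b x) = cls_scale (a * b) x.
Proof. by rewrite -(cls_repr x) !cls_scaleE scalerA. Qed.

Lemma cls_scale1 x : cls_scale 1 x = x.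
Proof. by rewrite -(cls_repr x) !cls_scaleE scale1r. Qed.

Lemma cls_scaleDr a x y : cls_scale a (x + y) = cls_scale a x + cls_scale a y.
Proof.
by rewrite -(cls_repr x) -(cls_repr y) -clsD !cls_scaleE -clsD scalerDr.
Qed.

Lemma cls_scaleDl x a b : cls_scale (a + b) x = cls_scale a x + cls_scale b x.
Proof. by rewrite -(cls_repr x) !cls_scaleE -clsD scalerDl. Qed.

HB.instance Definition _ := GRing.Zmodule_isLmodule.Build C completion
  cls_scaleA cls_scale1 cls_scaleDr cls_scaleDl.

Lemma clsZ c u : cls (c *: u) = c *: cls u.
Proof. by rewrite -cls_scaleE. Qed.

Lemma cauchy_seqP (u : cauchy_seq) : is_cauchy_seq u.
Proof. by apply/asboolP; exact: valP u. Qed.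

Lemma cauchy_seq_bounded (u : cauchy_seq) : exists2 M : C, 0 < M &
  exists N, forall n, (N <= n)%N -> seminorm s (u n) <= M.
Proof.
have [N uN] := @cauchy_seqP u 1 ltr01.
exists (seminorm s (u N) + 1); first by rewrite ltr_wpDl ?seminorm_ge0.
exists N => n Nn; rewrite -[u n](subrK (u N)) addrC.
by apply: le_trans (seminormD _ _ _) _; rewrite lerD2l ltW// uN.
Qed.

Definition dotseq (u v : cauchy_seq) : C :=
  limn (fun n => s (u n) (v n) : C^o).

Lemma is_cvg_dotseq (u v : cauchy_seq) : cvgn (fun n => s (u n) (v n) : C^o).
Proof.
apply: complex_cauchy_cvg => e e0.
have [A A0 [N uA]] := cauchy_seq_bounded u.
have [B B0 [M vB]] := cauchy_seq_bounded v.
have [|N' uN] := @cauchy_seqP u (e / 2 / B); first by rewrite !divr_gt0.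
have [|M' vM] := @cauchy_seqP v (e / 2 / A); first by rewrite !divr_gt0.
exists (maxn (maxn N N') (maxn M M')) => m n; rewrite !geq_max.
move=> /andP[/andP[Nm Nm'] /andP[Mm Mm']] /andP[/andP[Nn Nn'] /andP[Mn Mn']].
have -> : s (u m) (v m) - s (u n) (v n) = s (u m - u n) (v m) + s (u n) (v m - v n).
  by rewrite formBl formBr; ring.
apply: le_lt_trans (ler_normD _ _) _; rewrite [e]splitr; apply: ltrD.
  apply: le_lt_trans (le_form_seminorm _ _ _) _.
  apply: (@le_lt_trans _ _ (seminorm s (u m - u n) * B)).
    by rewrite ler_wpM2l ?seminorm_ge0// vB.
  by rewrite -ltr_pdivlMr// uN.
apply: le_lt_trans (le_form_seminorm _ _ _) _.
apply: (@le_lt_trans _ _ (A * seminorm s (v m - v n))).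
  by rewrite ler_wpM2r ?seminorm_ge0// uA.
by rewrite mulrC -ltr_pdivlMr// vM.
Qed.

Lemma dotseq_cvg (u v : cauchy_seq) :
  (fun n => s (u n) (v n) : C^o) @ \oo --> (dotseq u v : C^o).
Proof. exact: is_cvg_dotseq. Qed.

Lemma dotseq_eq (u v : cauchy_seq) (l : C) :
  (fun n => s (u n) (v n) : C^o) @ \oo --> (l : C^o) -> dotseq u v = l.
Proof. by move=> h; apply: cvg_lim h; exact: norm_hausdorff. Qed.

Lemma dotseqDZr c u v w : dotseq u (c *: v + w) = c * dotseq u v + dotseq u w.
Proof.
apply: dotseq_eq.
under eq_fun do rewrite formDZr.
apply: cvgD; last exact: dotseq_cvg.
by apply: (@cvgM C^o); [exact: cvg_cst|exact: dotseq_cvg].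
Qed.

Lemma norm_conjc (c : C) : `|conjc c| = `|c|.
Proof. by rewrite !normc_def; case: c => a b /=; rewrite sqrrN. Qed.

Lemma dotseq_conj u v : conjc (dotseq u v) = dotseq v u.
Proof.
apply/esym/dotseq_eq/cvgrPdist_lt => e e0.
have /cvgrPdist_lt/(_ _ e0) := @dotseq_cvg u v.
by apply: filterS => n; rewrite -(form_conj s (u n)) -rmorphB norm_conjc.
Qed.

Lemma dotseq_ge0 u : 0 <= dotseq u u.
Proof.
by apply: complex_cvg_ge0 (@dotseq_cvg u u) _; near=> n; exact: form_ge0.
Unshelve. all: by end_near. Qed.

Lemma dotseq_nullr (u v : cauchy_seq) : is_null_seq v -> dotseq u v = 0.
Proof.
move=> v0; apply: dotseq_eq; apply/cvgrPdist_lt => e e0.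
have [A A0 [N uA]] := cauchy_seq_bounded u.
have [|M vM] := v0 (e / A); first by rewrite divr_gt0.
exists (maxn N M) => // n /=; rewrite geq_max => /andP[Nn Mn].
rewrite sub0r normrN; apply: le_lt_trans (le_form_seminorm _ _ _) _.
apply: (@le_lt_trans _ _ (A * seminorm s (v n))).
  by rewrite ler_wpM2r ?seminorm_ge0// uA.
by rewrite mulrC -ltr_pdivlMr// vM.
Qed.

Definition cls_form (x y : completion) : C := dotseq (repr x) (repr y).

Lemma cls_formE u v : cls_form (cls u) (cls v) = dotseq u v.
Proof.
have dr a b : dotseq a (repr (cls b)) = dotseq a b.
  have := dotseqDZr 1 a (repr (cls b) - b) b.
  by rewrite scale1r subrK (dotseq_nullr a (@repr_cls b)) mulr0 add0r.
by rewrite /cls_form dr -dotseq_conj dr dotseq_conj.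
Qed.

Lemma cls_formDZr c x y z :
  cls_form x (c *: y + z) = c * cls_form x y + cls_form x z.
Proof.
rewrite -(cls_repr x) -(cls_repr y) -(cls_repr z) -clsZ -clsD !cls_formE.
exact: dotseqDZr.
Qed.

Lemma cls_form_conj x y : conjc (cls_form x y) = cls_form y x.
Proof. exact: dotseq_conj. Qed.

Lemma cls_form_ge0 x : 0 <= cls_form x x.
Proof. exact: dotseq_ge0. Qed.

Definition completion_form : semi_inner completion :=
  SemiInner cls_formDZr cls_form_conj cls_form_ge0.

Lemma cls_form_eq0 x : seminorm completion_form x = 0 -> x = 0.
Proof.
move=> x0; have {x0} : dotseq (repr x) (repr x) = 0.
  by have := seminorm_sqr completion_form x; rewrite x0 expr0n.
have /cvgrPdist_lt := @dotseq_cvg (repr x) (repr x); move=> + d0; rewrite d0 => xn.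
rewrite -(cls_repr x) -[0](subrr (cls 0)) -clsN -clsD; apply/eq_cls => e e0.
have [|N _ xN] := xn (e ^+ 2); first by rewrite exprn_gt0.
exists N => n /xN; rewrite !subr0 sub0r normrN -seminorm_sqr.
by rewrite ger0_norm ?exprn_ge0 ?seminorm_ge0// ltr_pXn2r// ?nnegrE ?seminorm_ge0// ltW.
Qed.

HB.instance Definition _ := Lmodule_isNormed.Build C completion
  (@seminormD _ _ completion_form) (@seminormZ _ _ completion_form) cls_form_eq0.

Lemma completion_normE (x : completion) : `|x| = seminorm completion_form x.
Proof. by []. Qed.

Lemma norm_cls_le (u : cauchy_seq) (e : C) : 0 <= e ->
  (exists N, forall n, (N <= n)%N -> seminorm s (u n) <= e) -> `|cls u| <= e.
Proof.
move=> e0 [N uN]; rewrite -(@ler_pXn2r _ 2)// ?nnegrE ?normr_ge0//.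
rewrite completion_normE seminorm_sqr /= cls_formE -subr_ge0.
apply: (@complex_cvg_ge0 R (fun n => e ^+ 2 - s (u n) (u n) : C^o)).
  by apply: cvgB; [exact: cvg_cst|exact: dotseq_cvg].
exists N => // n /= Nn; rewrite subr_ge0 -seminorm_sqr.
by rewrite ler_pXn2r// ?nnegrE ?seminorm_ge0// uN.
Qed.

Lemma const_cauchy (x : V) : (fun=> x) \in cauchy_pred.
Proof. by apply/asboolP => e e0; exists 0%N => *; rewrite subrr seminorm0. Qed.

Definition to_completion (x : V) : completion := cls (CauchySeq (const_cauchy x)).

Lemma to_completionD x y :
  to_completion (x + y) = to_completion x + to_completion y.
Proof. by rewrite -clsD; congr cls; apply: val_inj. Qed.

Lemma to_completionZ c x : to_completion (c *: x) = c *: to_completion x.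
Proof. by rewrite -clsZ; congr cls; apply: val_inj. Qed.

Lemma to_completion_form x y :
  completion_form (to_completion x) (to_completion y) = s x y.
Proof. 
rewrite /= cls_formE; apply: dotseq_eq.
have : (fun=> s x y : C^o) @ \oo --> (s x y : C^o) by exact: cvg_cst.
exact.
 Qed.

Lemma norm_to_completion x : `|to_completion x| = seminorm s x.
Proof. by rewrite completion_normE /seminorm to_completion_form. Qed.

Lemma to_completion_cvg (u : cauchy_seq) (e : C) : 0 < e ->
  exists N, forall n, (N <= n)%N -> `|cls u - to_completion (u n)| < e.
Proof.
move=> e0; have [|N uN] := @cauchy_seqP u (e / 2); first by rewrite divr_gt0.
exists N => n Nn; rewrite -clsN -clsD.
apply: (@le_lt_trans _ _ (e / 2)); last by rewrite ltr_pdivrMr// ltr_pMr// ltr1n.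
apply: norm_cls_le; first by rewrite ltW// divr_gt0.
by exists N => k Nk; rewrite ltW// uN.
Qed.

Lemma completion_complete (F : set_system completion) :
  ProperFilter F -> cauchy F -> cvg F.
Proof.
move=> FF /cauchyP FC.
have inv_gt0 n : 0 < n.+1%:R^-1 :> C by rewrite invr_gt0 ltr0n.
have invE n : n.+1%:R^-1 = (n.+1%:R^-1 : R)%:C :> C.
  by rewrite fmorphV/= rmorph_nat.
have small (e : C) : 0 < e -> exists N, forall n, (N <= n)%N -> n.+1%:R^-1 < e.
  case: e => a b; rewrite ltcE/= => /andP[/eqP -> a0].
  have [N _ aN] := near_infty_natSinv_lt (PosNum a0).
  by exists N => n /aN /= h; rewrite invE ltcR.
have /choice[x Fx] n : exists x : completion, F (ball x n.+1%:R^-1).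
  exact: FC.
have /choice[w xw] n : exists v, `|x n - to_completion v| < n.+1%:R^-1.
  have [N xN] := to_completion_cvg (repr (x n)) (inv_gt0 n).
  by exists (repr (x n) N); rewrite -[X in X - _]cls_repr xN.
have wC : w \in cauchy_pred.
  apply/asboolP => e e0; have [|N eN] := small (e / 4); first by rewrite divr_gt0.
  exists N => m n Nm Nn.
  rewrite -norm_to_completion to_completionD -scaleN1r to_completionZ scaleN1r.
  have [z [zm zn]] : (ball (x m) m.+1%:R^-1 `&` ball (x n) n.+1%:R^-1) !=set0.
    by apply: (@filter_ex _ F); apply: filterI; exact: Fx.
  move: zm zn; rewrite -!ball_normE/= => zm zn.
  have -> : to_completion (w m) - to_completion (w n) =
    (to_completion (w m) - x m) + (x m - z) + ((z - x n) + (x n - to_completion (w n))).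
    by rewrite !subrKA.
  have -> : e = (e / 4 + e / 4) + (e / 4 + e / 4) by field.
  apply: le_lt_trans (ler_normD _ _) _; apply: ltrD.
    apply: le_lt_trans (ler_normD _ _) _; apply: ltrD.
      by rewrite distrC (lt_trans (xw m))// eN.
    by rewrite (lt_trans zm)// eN.
  apply: le_lt_trans (ler_normD _ _) _; apply: ltrD.
    by rewrite distrC (lt_trans zn)// eN.
  by rewrite (lt_trans (xw n))// eN.
apply/cvg_ex; exists (cls (CauchySeq wC)).
apply/cvg_ballP => e e0.
have [|N eN] := small (e / 4); first by rewrite divr_gt0.
have [|M wM] := to_completion_cvg (CauchySeq wC) (e := e / 4); first by rewrite divr_gt0.
pose n := maxn N M.
apply: filterS (Fx n) => z; rewrite -!ball_normE/= => zn.
have -> : cls (CauchySeq wC) - z = (cls (CauchySeq wC) - to_completion (w n)) +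
  ((to_completion (w n) - x n) + (x n - z)) by rewrite !subrKA.
have -> : e = e / 4 + (e / 4 + e / 2) by field.
apply: le_lt_trans (ler_normD _ _) _; apply: ltrD; first by rewrite wM// leq_maxr.
apply: le_lt_trans (ler_normD _ _) _; apply: ltrD.
  by rewrite distrC (lt_trans (xw n))// eN// leq_maxl.
rewrite (lt_trans zn)// (lt_trans (eN n (leq_maxl _ _)))//.
by rewrite ltr_pM2l// ltf_pV2 ?posrE ?ltr0n// ltr_nat.
Qed.

HB.instance Definition _ := Uniform_isComplete.Build completion
  completion_complete.

Lemma completion_form_norm (x : completion) : completion_form x x = `|x| ^+ 2.
Proof. by rewrite completion_normE seminorm_sqr. Qed.

HB.instance Definition _ := hasInner.Build R completion
  (formDZr completion_form) (form_conj completion_form) completion_form_norm.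

Lemma to_completion_dot x y : dot (to_completion x) (to_completion y) = s x y.
Proof. exact: to_completion_form. Qed.

Lemma dense_to_completion : dense (range to_completion).
Proof.
move=> O [x Ox] oO; have /nbhs_ballP[e /= e0 xeO] := open_nbhs_nbhs (conj oO Ox).
have [N xN] := to_completion_cvg (repr x) e0.
exists (to_completion (repr x N)); split; last by exists (repr x N).
by apply: xeO; rewrite -ball_normE/= -[X in X - _]cls_repr xN.
Qed.

End Completion.


Definition is_bounded (R : realType) (V W : normedModType R[i]) (f : V -> W) :=
  exists M : R[i], forall v, `|f v| <= M * `|v|.

Definition is_opnorm (R : realType) (V : normedModType R[i]) (f : V -> R[i])
    (c : R[i]) : Prop :=
  [/\ 0 <= c, (forall v, `|f v| <= c * `|v|) &
    forall c', 0 <= c' -> (forall v, `|f v| <= c' * `|v|) -> c <= c'].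

(* MathComp has no structure joining rings with normed modules other than     *)
(* number domains, so the product is part of the mixin. The unit is allowed   *)
(* to be 0: the zero algebra is not excluded.                                 *)
HB.mixin Record isCStarAlgebra (R : realType) A
    of CompleteNormedModule R[i] A := {
  cone : A;
  cmul : A -> A -> A;
  star : A -> A;
  cmulA : associative cmul;
  cmul1l : left_id cone cmul;
  cmul1r : right_id cone cmul;
  cmulDl : left_distributive cmul +%R;
  cmulDr : right_distributive cmul +%R;
  cmulZl : forall (c : R[i]) (a b : A), cmul (c *: a) b = c *: cmul a b;
  cmulZr : forall (c : R[i]) (a b : A), cmul a (c *: b) = c *: cmul a b;
  norm_cmul : forall a b : A, `|cmul a b| <= `|a| * `|b|;
  starK : involutive star;
  starD : forall a b : A, star (a + b) = star a + star b;
  starZ : forall (c : R[i]) (a : A), star (c *: a) = conjc c *: star a;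
  star_cmul : forall a b : A, star (cmul a b) = cmul (star b) (star a);
  norm_star_cmul : forall a : A, `|cmul (star a) a| = `|a| ^+ 2 }.

#[short(type="cstarType")]
HB.structure Definition CStarAlgebra (R : realType) :=
  {A of CompleteNormedModule R[i] A & isCStarAlgebra R A}.

Definition positive (R : realType) (A : cstarType R) (a : A) : Prop :=
  exists b : A, a = cmul (star b) b.

(* A W*-algebra is a C*-algebra that is a dual Banach space: [pairing]        *)
(* identifies A isometrically with the dual of [predual]. Conversely,         *)
(* [predual] is the space A_* of the functionals [pairing^~ phi] on A.        *)
HB.mixin Record hasPredual (R : realType) A of CStarAlgebra R A := {
  predual : completeNormedModType R[i];
  pairing : A -> predual -> R[i];
  pairingDZl : forall (c : R[i]) (a b : A) (phi : predual),
    pairing (c *: a + b) phi = c * pairing a phi + pairing b phi;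
  pairingDZr : forall (a : A) (c : R[i]) (phi psi : predual),
    pairing a (c *: phi + psi) = c * pairing a phi + pairing a psi;
  pairing_isometry : forall a : A, is_opnorm (pairing a) `|a|;
  pairing_onto : forall f : predual -> R[i]^o, linear f -> is_bounded f ->
    exists a : A, forall phi, f phi = pairing a phi }.

#[short(type="wstarType")]
HB.structure Definition WStarAlgebra (R : realType) :=
  {A of CStarAlgebra R A & hasPredual R A}.

Arguments predual {R} A : rename.

(* Right modules; the inner product is A-linear in the second variable. *)
HB.mixin Record isHilbertModule (R : realType) (A : cstarType R) E
    of CompleteNormedModule R[i] E := {
  act : E -> A -> E;
  actDl : forall (x y : E) (a : A), act (x + y) a = act x a + act y a;
  actDr : forall (x : E) (a b : A), act x (a + b) = act x a + act x b;
  act_cmul : forall (x : E) (a b : A), act x (cmul a b) = act (act x a) b;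
  act1 : forall x : E, act x cone = x;
  actZl : forall (c : R[i]) (x : E) (a : A), act (c *: x) a = c *: act x a;
  actZr : forall (c : R[i]) (x : E) (a : A), act x (c *: a) = c *: act x a;
  inner : E -> E -> A;
  innerDZr : forall (x : E) (c : R[i]) (y z : E),
    inner x (c *: y + z) = c *: inner x y + inner x z;
  inner_act : forall (x y : E) (a : A),
    inner x (act y a) = cmul (inner x y) a;
  star_inner : forall x y : E, star (inner x y) = inner y x;
  inner_positive : forall x : E, positive (inner x x);
  norm_inner : forall x : E, `|x| ^+ 2 = `|inner x x| }.

#[short(type="hilbertModType")]
HB.structure Definition HilbertModule (R : realType) (A : cstarType R) :=
  {E of CompleteNormedModule R[i] E & isHilbertModule R A E}.

Definition self_dual (R : realType) (A : cstarType R) (E : hilbertModType A) :=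
  forall tau : E -> A, linear tau ->
    (forall (y : E) (a : A), tau (act y a) = cmul (tau y) a) ->
    is_bounded tau ->
  exists x : E, forall y : E, tau y = inner x y.

Definition is_submodule (R : realType) (A : cstarType R) (E : hilbertModType A)
    (L : set E) : Prop :=
  [/\ L 0, (forall x y, L x -> L y -> L (x + y)),
    (forall (c : R[i]) x, L x -> L (c *: x)) &
    (forall x (a : A), L x -> L (act x a))].

Section WeakStar.
Variables (R : realType) (A : wstarType R) (E : hilbertModType A).

Record weak_star_index := WeakStarIndex {
  coef : nat -> R;
  normal_fun : nat -> predual A;
  vect : nat -> E;
  coef_gt0 : forall j, 0 < coef j;
  coef_summable : cvgn (series coef);
  norm_normal_fun : forall j, `|normal_fun j| = 1;
  norm_vect : forall j, `|vect j| = 1 }.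

Definition weak_star_fun (i : weak_star_index) (x : E) : R[i]^o :=
  limn (series (fun j => (coef i j)%:C *
    pairing (inner x (vect i j)) (normal_fun i j) : R[i]^o)).

Definition weak_star : topologicalType := sup_topology
  (fun i => Topological.on (initial_topology (weak_star_fun i))).

End WeakStar.

Record pos_functional (R : realType) (A : cstarType R) := PosFunctional {
  pos_fun :> A -> R[i]^o;
  pos_fun_linear : linear pos_fun;
  pos_fun_ge0 : forall a : A, positive a -> 0 <= (pos_fun a : R[i]) }.

Definition is_state (R : realType) (A : cstarType R) (omega : pos_functional A) :=
  is_opnorm omega 1.

Definition is_normal (R : realType) (A : wstarType R) (omega : pos_functional A) :=
  exists phi : predual A, forall a, omega a = pairing a phi.

Section GNS.
Variables (R : realType) (A : cstarType R) (E : hilbertModType A).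
Variable omega : pos_functional A.

Lemma omega_innerDZr (c : R[i]) (x y z : E) :
  omega (inner x (c *: y + z)) = c * omega (inner x y) + omega (inner x z).
Proof. by rewrite innerDZr pos_fun_linear. Qed.

Lemma omega_inner_ge0 (x : E) : 0 <= (omega (inner x x) : R[i]).
Proof. exact/pos_fun_ge0/inner_positive. Qed.

Lemma omega_inner_conj (x y : E) :
  conjc (omega (inner x y)) = omega (inner y x).
Proof.
have omD a b : omega (a + b) = omega a + omega b.
  by have := pos_fun_linear omega 1 a b; rewrite !scale1r.
have om0 : omega 0 = 0.
  by have /eqP := omD 0 0; rewrite addr0 -subr_eq subrr => /eqP.
have omZ c a : omega (c *: a) = c * omega a.
  by have := pos_fun_linear omega c a 0; rewrite om0 !addr0.
have iDr (p q r : E) : inner p (q + r) = inner p q + inner p r.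
  by have := innerDZr p 1 q r; rewrite !scale1r.
have i0r (p : E) : inner p 0 = 0.
  by have /eqP := iDr p 0 0; rewrite addr0 -subr_eq subrr => /eqP.
have iZr c (p q : E) : inner p (c *: q) = c *: inner p q.
  by have := innerDZr p c q 0; rewrite i0r !addr0.
pose f (u v : E) : R[i] := omega (inner u v).
have fDr u v w : f u (v + w) = f u v + f u w by rewrite /f iDr omD.
have fZr c u v : f u (c *: v) = c * f u v by rewrite /f iZr omZ.
have fDl u v w : f (u + v) w = f u w + f v w.
  by rewrite /f -(star_inner w (u + v)) iDr starD !star_inner omD.
have fZl c u v : f (c *: u) v = conjc c * f u v.
  by rewrite /f -(star_inner v (c *: u)) iZr starZ !star_inner omZ.
have Imf z : complex.Im (f z z) = 0.
  by have := omega_inner_ge0 z; rewrite -/(f z z) lecE/= => /andP[/eqP].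
have := Imf (x + y); have := Imf (x + 'i *: y).
rewrite !fDl !fDr !fZl !fZr -/(f x y) -/(f y x).
move: (Imf x) (Imf y).
case: (f x x) => a1 b1; case: (f y y) => a2 b2; case: (f x y) => a3 b3;
  case: (f y x) => a4 b4 /= -> -> h1 h2.
apply/eqP; rewrite eq_complex/=; apply/andP; split; apply/eqP; lra.
Qed.

Definition gns_form : semi_inner E :=
  SemiInner omega_innerDZr omega_inner_conj omega_inner_ge0.

Definition gns_kernel : set E := [set x | omega (inner x x) = 0].

(* E_omega: the completion of E / gns_kernel, see [gns_map_eq]. *)
Definition gns_space : hilbertType R := completion gns_form.

Definition gns_map (x : E) : gns_space := to_completion gns_form x.

Lemma gns_map_eq (x y : E) : gns_map x = gns_map y <-> gns_kernel (x - y).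
Proof.
have E1 : gns_map x - gns_map y = gns_map (x - y).
  by rewrite /gns_map -[- y]scaleN1r to_completionD to_completionZ scaleN1r.
have E2 : `|gns_map (x - y)| ^+ 2 = omega (inner (x - y) (x - y)).
  by rewrite -dot_norm; exact: to_completion_dot.
split=> [xy|k].
  by rewrite /gns_kernel/= -E2 -E1 xy subrr normr0 expr0n.
move: E2; rewrite [RHS]k -E1 => /eqP.
by rewrite expf_eq0/= normr_eq0 subr_eq0 => /eqP.
Qed.

Lemma gns_map_dot (x y : E) : dot (gns_map x) (gns_map y) = omega (inner x y).
Proof. exact: to_completion_dot. Qed.

Lemma dense_gns_map : dense (range gns_map).
Proof. exact: dense_to_completion. Qed.

End GNS.

(* Main.v *)
(* A weak* neighbourhood of x0 that misses L is controlled by finitely many   *)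
(* functionals f(x) = sum_j lambda_j tau_j(<x, y_j>). Every normal functional *)
(* tau of norm 1 is dominated on the positive cone by a positive normal omega *)
(* of norm at most 8; polarization then gives, for all s > 0,                 *)
(*   |tau(<x, y>)| <= s^-2 omega(<x, x>) + s^2 omega(<y, y>).                 *)
(* Summing over j, a seminorm ball {x : omega(<x - x0, x - x0>) < e} misses L *)
(* for one positive normal omega, and normalising omega gives the state: the  *)
(* image of x0 stays at positive distance from that of L.                     *)
(*                                                                            *)
(* The domination of tau is a Krein-Smulian argument. Positivity is expressed *)
(* by norms, hence cut out of the ball by weak* compact sets; a minimax       *)
(* argument yields approximate majorants in the predual, and halving the      *)
(* error repeatedly gives an exact one. That b* b is positive in this sense   *)
(* is the Kelley-Vaught theorem, proved without spectral theory.              *)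

(* The weak* topology of E is coarser than the topology of the seminorms omega(<x, x>), with omega
   normal and positive, and these are directed because the omega can be added. So a single omega
   separates a weak* interior point x0 of the complement from L ([weak_star_nbhs]). In the
   completion for omega that seminorm is the squared distance to the image of x0, and minimising the
   distance produces a vector orthogonal to the image of L ([orthogonal_complement_neq0]).

   The comparison of topologies rests on [normal_dominate]. Order is expressed by norms: [pos] asks
   for a ball around some t, of radius t, that contains h, and [pos_nm_sub] allows t to be any bound
   of |h|. Bounded positive elements are therefore stable under weak* limits ([wcvg_pos]), and
   [wcvg_exists] supplies such limits along ultrafilters. For a normal tau of norm at most 1, Re
   tau(p1) - Re tau(p2) is at most twice the norm of p1 + p2 + i h, when p1, p2 are positive and h
   is self-adjoint. Hahn-Banach would give a majorant in the dual of A; to stay in the predual,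
   [gap_halve] finds a correction in a ball that halves the error, by a minimax exchange over a
   weak* compact set, and [normal_majorant] sums the corrections. Finally [pos_star_mul] makes <x,
   x> positive in the sense of [pos], so that the majorants apply to inner products. *)
Require Import Defs.
From HB Require Import structures.
From mathcomp Require Import all_boot all_order all_algebra.
From mathcomp Require Import boolp classical_sets functions interval_inference.
From mathcomp Require Import reals topology normedtype sequences complex.
From mathcomp Require Import ring lra.

Set Implicit Arguments.
Unset Strict Implicit.
Unset Printing Implicit Defensive.

Import Order.TTheory GRing.Theory Num.Theory.
Import numFieldNormedType.Exports.

Local Open Scope classical_set_scope.
Local Open Scope ring_scope.
Local Open Scope complex_scope.

(* The tactic [zmod] decides equations between sums in an abelian group; the  *)
(* algebras below are not commutative, which rules out [ring].                *)
Inductive zmod_expr := ZVar of nat | ZZero | ZOpp of zmod_expr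
  | ZAdd of zmod_expr & zmod_expr.

Fixpoint zmod_eval (V : zmodType) (env : seq V) t : V :=
  match t with
  | ZVar i => env`_i
  | ZZero => 0
  | ZOpp u => - zmod_eval env u
  | ZAdd u v => zmod_eval env u + zmod_eval env v
  end.

Fixpoint zmod_coef t (i : nat) : int :=
  match t with
  | ZVar j => (i == j)%:Z
  | ZZero => 0
  | ZOpp u => - zmod_coef u i
  | ZAdd u v => zmod_coef u i + zmod_coef v i
  end.

Lemma zmod_evalE (V : zmodType) (env : seq V) t :
  zmod_eval env t = \sum_(i < size env) env`_i *~ zmod_coef t i.
Proof.
elim: t => [j||u ihu|u ihu v ihv] /=.
- have [js|js] := ltnP j (size env).
    rewrite (bigD1 (Ordinal js))//= eqxx big1 ?addr0// => i.
    by rewrite -val_eqE/= => /negPf->.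
  (* Beyond the environment a variable takes the default value 0, and no index of the sum meets
     it. *)
  rewrite nth_default// big1// => i _.
  by rewrite (ltn_eqF (leq_trans (ltn_ord i) js)).
- by rewrite big1.
- by rewrite ihu -sumrN; apply: eq_bigr => i _; rewrite mulrNz.
- by rewrite ihu ihv -big_split; apply: eq_bigr => i _; rewrite mulrzDr.
Qed.

Lemma zmod_eval_eq (V : zmodType) (env : seq V) t u :
  all (fun i => zmod_coef t i == zmod_coef u i) (iota 0 (size env)) ->
  zmod_eval env t = zmod_eval env u.
Proof.
move=> /allP tu; rewrite !zmod_evalE; apply: eq_bigr => i _.
by have /eqP-> : zmod_coef t i == zmod_coef u i by apply: tu; rewrite mem_iota/=.
Qed.

Ltac zmod_in x l :=
  match l with
  | nil => constr:(false)
  | ?y :: _ => let _ := match goal with _ => unify x y end in constr:(true)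
  | _ :: ?l' => zmod_in x l'
  end.

Ltac zmod_index x l :=
  match l with
  | ?y :: _ => let _ := match goal with _ => unify x y end in constr:(0%N)
  | _ :: ?l' => let n := zmod_index x l' in constr:(S n)
  end.

Ltac zmod_atoms t l :=
  lazymatch t with
  | (?a + ?b)%R => let l' := zmod_atoms a l in zmod_atoms b l'
  | (- ?a)%R => zmod_atoms a l
  | 0%R => l
  | _ => lazymatch zmod_in t l with
         | true => l
         | false => constr:(t :: l)
         end
  end.

Ltac zmod_reify t l :=
  lazymatch t with
  | (?a + ?b)%R =>
    let u := zmod_reify a l in let v := zmod_reify b l in constr:(ZAdd u v)
  | (- ?a)%R => let u := zmod_reify a l in constr:(ZOpp u)
  | 0%R => constr:(ZZero)
  | _ => let n := zmod_index t l in constr:(ZVar n)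
  end.

Ltac zmod :=
  lazymatch goal with
  | |- @eq ?T ?a ?b =>
    let l := zmod_atoms a (@nil T) in
    let l := zmod_atoms b l in
    let u := zmod_reify a l in
    let v := zmod_reify b l in
    refine (@zmod_eval_eq _ l u v _); vm_compute; exact isT
  end.

(** * Real-valued norms over the complex field *)

Section RealNorm.
Variables (R : realType) (V : normedZmodType R[i]).
Implicit Types x y : V.

Definition nm x : R := complex.Re `|x|.

Lemma nmE x : `|x| = (nm x)%:C.
Proof.
rewrite /nm; have := normr_ge0 x; case: `|x| => a b.
by rewrite lecE/= => /andP[/eqP-> _].
Qed.

Lemma nm_ge0 x : 0 <= nm x.
Proof. by rewrite -lecR -nmE normr_ge0. Qed.

Lemma nm0 : nm 0 = 0.
Proof. by rewrite /nm normr0. Qed.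

Lemma nm0_eq0 x : nm x = 0 -> x = 0.
Proof. by move=> x0; apply/normr0_eq0; rewrite nmE x0. Qed.

Lemma nmD x y : nm (x + y) <= nm x + nm y.
Proof. by rewrite -lecR rmorphD/= -!nmE ler_normD. Qed.

Lemma nmN x : nm (- x) = nm x.
Proof. by rewrite /nm normrN. Qed.

Lemma nmB x y : nm (x - y) = nm (y - x).
Proof. by rewrite -nmN opprB. Qed.

Lemma nmDB x y : nm (x - y) <= nm x + nm y.
Proof. by rewrite -(nmN y) nmD. Qed.

Lemma nm_dist z x y : nm (x - y) <= nm (x - z) + nm (z - y).
Proof. by rewrite -(subrKA z) nmD. Qed.

Lemma nm_le_dist x y : nm x <= nm y + nm (x - y).
Proof. by rewrite -[X in nm X <= _](subrK y) addrC nmD. Qed.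

End RealNorm.

Section ComplexNm.
Variable R : realType.
Implicit Types c d : R[i].

Lemma nmM c d : nm (c * d) = nm c * nm d.
Proof. by apply/complexI; rewrite rmorphM/= -!nmE normrM. Qed.

Lemma nm_real (t : R) : nm t%:C = `|t|.
Proof. by rewrite /nm normc_def/= expr0n addr0 sqrtr_sqr. Qed.

Lemma normRe_nm c : `|complex.Re c| <= nm c.
Proof.
case: c => a b; rewrite /nm normc_def/= -sqrtr_sqr.
by rewrite ler_sqrt ?addr_ge0 ?sqr_ge0// lerDl sqr_ge0.
Qed.

Lemma Re_nm c : complex.Re c <= nm c.
Proof. exact: le_trans (ler_norm _) (normRe_nm c). Qed.

Lemma nm_i : nm ('i : R[i]) = 1.
Proof. by rewrite /nm normc_def/= expr0n add0r expr1n sqrtr1. Qed.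

Lemma complexReIm c : c = (complex.Re c)%:C + 'i * (complex.Im c)%:C.
Proof.
by case: c => a b; apply/eqP; rewrite eq_complex/=; apply/andP; split;
  apply/eqP; ring.
Qed.

Lemma nm_le_ReIm c : nm c <= `|complex.Re c| + `|complex.Im c|.
Proof.
rewrite {1}[c]complexReIm (le_trans (nmD _ _))// nmM nm_i mul1r !nm_real//.
Qed.

Lemma posc_real (e : R[i]) : 0 < e -> exists2 r : R, 0 < r & e = r%:C.
Proof. by case: e => a b; rewrite ltcE/= => /andP[/eqP-> a0]; exists a. Qed.

End ComplexNm.

Section NormedMod.
Variables (R : realType) (V : normedModType R[i]).
Implicit Types (x y : V) (u : nat -> V).

Lemma nmZ (c : R[i]) x : nm (c *: x) = nm c * nm x.
Proof. by apply/complexI; rewrite rmorphM/= -!nmE normrZ. Qed.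

Lemma nmZr (t : R) x : nm (t%:C *: x) = `|t| * nm x.
Proof. by rewrite nmZ nm_real. Qed.

Lemma nm_cvgP u (l : V) : u @ \oo --> l <->
  forall e, 0 < e -> exists N, forall n, (N <= n)%N -> nm (l - u n) < e.
Proof.
split=> [/cvgrPdist_lt ul e e0|ul].
  have [N _ lN] := ul e%:C ltac:(by rewrite ltcR).
  by exists N => n /lN/=; rewrite nmE ltcR.
apply/cvgrPdist_lt => _ /posc_real[e e0 ->]; have [N lN] := ul e e0.
by exists N => // n /= /lN; rewrite nmE ltcR.
Qed.

Lemma nm_series_le u (b : nat -> R) n k :
  (forall n, nm (u n.+1 - u n) <= b n) ->
  nm (u (n + k)%N - u n) <= series b (n + k)%N - series b n.
Proof.
move=> ub; elim: k => [|k ih]; first by rewrite addn0 !subrr nm0.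
rewrite addnS (le_trans (nm_dist (u (n + k)%N) _ _))//.
rewrite (_ : series b (n + k).+1 = b (n + k)%N + series b (n + k)%N); last first.
  by rewrite /series/= big_nat_recr//= addrC.
by rewrite -addrA lerD.
Qed.

Lemma nm_cauchy_le u (b : nat -> R) : (forall n, nm (u n.+1 - u n) <= b n) ->
  cvgn (series b) -> forall e, 0 < e ->
  exists N, forall m n, (N <= m)%N -> (N <= n)%N -> nm (u m - u n) < e.
Proof.
move=> ub cb e e0.
have e2 : 0 < e / 2 by rewrite divr_gt0.
have /cvgrPdist_lt/(_ _ e2)[N _ bN] := cb.
exists N => m n Nm Nn; wlog nm : m n Nm Nn / (n <= m)%N.
  by move=> h; case/orP: (leq_total n m) => [|mn]; [exact: h|rewrite nmB h].
have := nm_series_le n (m - n) ub; rewrite subnKC//; move/le_lt_trans; apply.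
have /= := bN _ Nm; have /= := bN _ Nn; set l := limn _ => h1 h2.
by move: h1 h2; rewrite !ltr_norml => /andP[h1 h1'] /andP[h2 h2']; lra.
Qed.

End NormedMod.

Section CompleteMod.
Variables (R : realType) (V : completeNormedModType R[i]).

Lemma nm_complete (u : nat -> V) : (forall e, 0 < e ->
  exists N, forall m n, (N <= m)%N -> (N <= n)%N -> nm (u m - u n) < e) ->
  exists l : V, u @ \oo --> l.
Proof.
move=> uC; suff /cauchy_cvgP/cvg_ex[l ul] : cauchy (u @ \oo) by exists l.
apply/cauchy_ballP => _ /posc_real[e e0 ->]; have [N uN] := uC e e0.
exists ([set u n | n in [set n | (N <= n)%N]],
        [set u n | n in [set n | (N <= n)%N]]).
  by split; exists N => // n /= Nn; exists n.
move=> [_ _] [[m /= Nm <-] [n /= Nn <-]] /=.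
by rewrite -ball_normE/= nmE ltcR uN.
Qed.

Lemma nm_summable (u : nat -> V) (b : nat -> R) :
  (forall n, nm (u n.+1 - u n) <= b n) -> cvgn (series b) ->
  exists l : V, u @ \oo --> l.
Proof. by move=> ub cb; exact: nm_complete (nm_cauchy_le ub cb). Qed.

(** Banach's theorem on a closed set W: the limit of the iterates stays in W, which is how the fixed
    points below come out self-adjoint and in the double commutant. *)
Lemma contraction_fixpoint (W : V -> Prop) (F : V -> V) (q : R) (y0 : V) :
  0 <= q < 1 -> W y0 -> (forall y, W y -> W (F y)) ->
  (forall y z, W y -> W z -> nm (F y - F z) <= q * nm (y - z)) ->
  (forall y, (forall e, 0 < e -> exists2 z, W z & nm (y - z) < e) -> W y) ->
  exists2 y, W y & F y = y.
Proof.
move=> /andP[q0 q1] W0 WF Fq Wc; pose u n := iter n F y0.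
have Wu n : W (u n) by elim: n => //= n; exact: WF.
have ub n : nm (u n.+1 - u n) <= geometric (nm (F y0 - y0)) q n.
  elim: n => [|n ih]; first by rewrite /= mulr1.
  rewrite (le_trans (Fq _ _ (Wu n.+1) (Wu n)))//=.
  by rewrite exprS mulrCA ler_wpM2l.
have [|l /nm_cvgP ul] := nm_summable ub.
  by apply: is_cvg_geometric_series; rewrite ger0_norm.
have Wl : W l.
  by apply: Wc => e e0; have [N uN] := ul e e0; exists (u N); rewrite ?uN.
exists l => //; apply/eqP; rewrite -subr_eq0; apply/eqP/nm0_eq0.
apply/eqP; rewrite eq_le nm_ge0 andbT; apply/ler_addgt0Pl => e e0.
rewrite addr0; have [|N uN] := ul (e / 2); first by rewrite divr_gt0.
have h1 := uN N (leqnn _); have h2 := uN N.+1 (leqnSn _).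
apply: le_trans (nm_dist (u N.+1) _ _) _; rewrite [e in _ <= e]splitr.
rewrite lerD// 1?[nm (u N.+1 - l)]nmB; last exact: ltW.
apply: le_trans (Fq _ _ Wl (Wu N)) _; apply: le_trans (ltW h1).
by rewrite ler_piMl ?nm_ge0// ltW.
Qed.

End CompleteMod.

(** * Positivity in C*-algebras *)

HB.instance Definition _ (R : realType) (A : cstarType R) :=
  GRing.Zmodule_isPzRing.Build A (@cmulA R A) (@cmul1l R A) (@cmul1r R A)
    (@cmulDl R A) (@cmulDr R A).

Section CStar.
Variables (R : realType) (A : cstarType R).
Implicit Types (a b c x y z h k p q : A) (s t e : R).

Lemma scalAl (l : R[i]) a b : l *: (a * b) = (l *: a) * b.
Proof. exact: esym (cmulZl _ _ _). Qed.

Lemma scalAr (l : R[i]) a b : l *: (a * b) = a * (l *: b).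
Proof. exact: esym (cmulZr _ _ _). Qed.

Lemma nm_mul a b : nm (a * b) <= nm a * nm b.
Proof. by rewrite -lecR rmorphM/= -!nmE; exact: norm_cmul. Qed.

Lemma starM a b : star (a * b) = star b * star a.
Proof. exact: star_cmul. Qed.

Lemma starZr t a : star (t%:C *: a) = t%:C *: star a.
Proof. by rewrite starZ conjc_real. Qed.

Lemma star0 : star (0 : A) = 0.
Proof. by have := starZ 0 (0 : A); rewrite scale0r conjc0 scale0r. Qed.

Lemma starN a : star (- a) = - star a.
Proof.
by apply/eqP; rewrite -addr_eq0 -starD addNr star0.
Qed.

Lemma starB a b : star (a - b) = star a - star b.
Proof. by rewrite starD starN. Qed.

Lemma star1 : star (1 : A) = 1.
Proof. by rewrite -[LHS]mulr1 -[X in _ * X]starK -starM mulr1 starK. Qed.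

Lemma nm_star_mul a : nm (star a * a) = nm a ^+ 2.
Proof. by apply/complexI; rewrite rmorphXn/= -!nmE; exact: norm_star_cmul. Qed.

Lemma nm_star a : nm (star a) = nm a.
Proof.
suff le b : nm b <= nm (star b).
  by apply/eqP; rewrite eq_le le -{2}[a]starK le.
have [b0|b0] := eqVneq (nm b) 0; first by rewrite b0 nm_ge0.
have b_gt0 : 0 < nm b by rewrite lt_neqAle eq_sym b0 nm_ge0.
by rewrite -(ler_pM2r b_gt0) -expr2 -nm_star_mul nm_mul.
Qed.

Lemma nm_sqr h : star h = h -> nm (h * h) = nm h ^+ 2.
Proof. by move=> hh; rewrite -{1}hh nm_star_mul. Qed.

Lemma nm_one : nm (1 : A) <= 1.
Proof.
have := nm_sqr star1; rewrite mulr1 => h; have := nm_ge0 (1 : A).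
rewrite le_eqVlt => /orP[/eqP<-|n0]; first exact: ler01.
by rewrite -(ler_pM2r n0) mul1r -expr2 -h.
Qed.

Definition sc t : A := t%:C *: (1 : A).

Lemma scE t : t%:C *: (1 : A) = sc t. Proof. by []. Qed.
Lemma sc0 : sc 0 = 0. Proof. by rewrite /sc scale0r. Qed.
Lemma sc1 : sc 1 = 1. Proof. by rewrite /sc scale1r. Qed.
Lemma scD s t : sc (s + t) = sc s + sc t.
Proof. by rewrite /sc rmorphD/= scalerDl. Qed.
Lemma scN t : sc (- t) = - sc t.
Proof. by rewrite /sc rmorphN/= scaleNr. Qed.
Lemma scB s t : sc (s - t) = sc s - sc t.
Proof. by rewrite scD scN. Qed.
Lemma scM t a : sc t * a = t%:C *: a.
Proof. by rewrite /sc -scalAl mul1r. Qed.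
Lemma Msc t a : a * sc t = t%:C *: a.
Proof. by rewrite /sc -scalAr mulr1. Qed.
Lemma sc_mul s t : s%:C *: sc t = sc (s * t).
Proof. by rewrite /sc scalerA rmorphM. Qed.
Lemma scC t a : GRing.comm (sc t) a.
Proof. by rewrite /GRing.comm scM Msc. Qed.
Lemma star_sc t : star (sc t) = sc t.
Proof. by rewrite starZr star1. Qed.
Lemma nm_sc t : nm (sc t) <= `|t|.
Proof. by rewrite nmZr ler_piMr// nm_one. Qed.

(** Stands in for y being a function of x, in place of a functional calculus: y lies in the double
    commutant of x. *)
Definition bicomm x y := forall z, GRing.comm x z -> GRing.comm y z.

Lemma commZ (l : R[i]) y z : GRing.comm y z -> GRing.comm (l *: y) z.
Proof. by rewrite /GRing.comm -scalAl -scalAr => ->. Qed.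

Lemma commC y z : GRing.comm y z -> GRing.comm z y.
Proof. by move=> yz; exact: commr_sym. Qed.

Lemma commDl x y z : GRing.comm x z -> GRing.comm y z -> GRing.comm (x + y) z.
Proof. by move=> xz yz; apply/commC/commrD; exact: commC. Qed.

Lemma commMl x y z : GRing.comm x z -> GRing.comm y z -> GRing.comm (x * y) z.
Proof. by move=> xz yz; apply/commC/commrM; exact: commC. Qed.

Lemma comm1l z : GRing.comm 1 z.
Proof. by apply/commC/commr1. Qed.

Lemma selfadj_closed y :
  (forall e, 0 < e -> exists2 z, star z = z & nm (y - z) < e) -> star y = y.
Proof.
move=> yW; apply/eqP; rewrite -subr_eq0; apply/eqP/nm0_eq0/eqP.
rewrite eq_le nm_ge0 andbT; apply/ler_addgt0Pl => e e0; rewrite addr0.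
have [|z zz yz] := yW (e / 2); first by rewrite divr_gt0.
apply: le_trans (nm_dist z _ _) _; rewrite [e]splitr lerD//; last first.
  by rewrite nmB ltW.
by rewrite -[X in star y - X]zz -starB nm_star ltW.
Qed.

Lemma bicomm_closed x y :
  (forall e, 0 < e -> exists2 z, bicomm x z & nm (y - z) < e) -> bicomm x y.
Proof.
move=> yW w xw; apply/eqP; rewrite -subr_eq0; apply/eqP/nm0_eq0/eqP.
rewrite eq_le nm_ge0 andbT; apply/ler_addgt0Pl => e e0; rewrite addr0.
have w0 : 0 < nm w + 1 by rewrite ltr_wpDl ?nm_ge0.
have [|z /(_ _ xw) zz yz] := yW (e / 2 / (nm w + 1)); first by rewrite !divr_gt0.
have -> : y * w - w * y = (y - z) * w - w * (y - z).
  by rewrite mulrBl mulrBr opprB addrA zz subrK.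
apply: le_trans (nmDB _ _) _; rewrite [e]splitr.
move: yz; rewrite ltr_pdivlMr// => yz.
have h : nm (y - z) * nm w <= e / 2.
  by rewrite (le_trans _ (ltW yz))// ler_wpM2l ?nm_ge0// lerDl.
by rewrite lerD// (le_trans (nm_mul _ _))// mulrC.
Qed.

(* y is the fixed point of (x + y^2) / 2, so that (1 - y)^2 = 1 - x. *)
Lemma sqrt_sub1 x : star x = x -> nm x < 1 ->
  exists y, [/\ star y = y, nm y <= nm x, bicomm x y & y + y = x + y * y].
Proof.
move=> xx x1.
pose W y := [/\ star y = y, nm y <= nm x & bicomm x y].
have h2 : (2^-1 : R)%:C + (2^-1 : R)%:C = 1.
  by rewrite -rmorphD/= (_ : _ + _ = 1)//; lra.
have [|||y z [yy yx yb] [zz zx zb]|y yW|y [yy yx yb] yE] :=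
  @contraction_fixpoint R A W (fun y => (2^-1 : R)%:C *: (x + y * y)) (nm x) 0.
- by rewrite nm_ge0.
- by split; [exact: star0|rewrite nm0 nm_ge0|move=> z _; exact/commC/commr0].
- move=> y [yy yx yb]; split.
  + by rewrite starZr starD xx starM yy.
  + rewrite nmZr ger0_norm ?invr_ge0// mulrC ler_pdivrMr//.
    rewrite (le_trans (nmD _ _))// mulr_natr mulr2n lerD2l.
    rewrite (le_trans (nm_mul _ _))//.
    rewrite (le_trans _ yx)// ler_piMl ?nm_ge0// (le_trans yx)// ltW//.
  + by move=> z xz; apply: commZ; apply: commDl => //; apply: commMl; exact: yb.
- rewrite -scalerBr opprD addrACA subrr add0r.
  have -> : y * y - z * z = y * (y - z) + (y - z) * z.
    by rewrite mulrBr mulrBl addrA subrK.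
  rewrite nmZr ger0_norm ?invr_ge0// mulrC ler_pdivrMr//.
  rewrite (le_trans (nmD _ _))// mulrAC mulr_natr mulr2n [leRHS]mulrDl.
  apply: lerD; apply: le_trans (nm_mul _ _) _; last rewrite mulrC.
    by rewrite ler_wpM2r ?nm_ge0.
  by rewrite ler_wpM2r ?nm_ge0.
- split.
  + by apply: selfadj_closed => e /yW[z [? _ _] ?]; exists z.
  + apply/ler_addgt0Pl => e /yW[z [_ zx _] yz].
    by rewrite (le_trans (nm_le_dist y z))// addrC lerD// ltW.
  + by apply: bicomm_closed => e /yW[z [? _ ?] ?]; exists z.
- exists y; split => //.
  by rewrite -{1 2}yE -scalerDl h2 scale1r.
Qed.

(** The Neumann series, obtained as the fixed point of y = 1 + x y. *)
Lemma inv_sub1 x : star x = x -> nm x < 1 ->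
  exists g, [/\ star g = g, bicomm x g & g * (1 - x) = 1].
Proof.
move=> xx x1.
pose W y := star y = y /\ bicomm x y.
have [||||y yW|y [yy yb] yE] :=
  @contraction_fixpoint R A W (fun y => 1 + x * y) (nm x) 0.
- by rewrite nm_ge0.
- by split; [exact: star0|move=> z _; exact/commC/commr0].
- move=> y [yy yb]; split.
    by rewrite starD star1 starM xx yy (yb x (commr_refl _)).
  move=> z xz; apply: commDl; first exact: comm1l.
  by apply: commMl => //; exact: yb.
- move=> y z _ _; rewrite opprD addrACA subrr add0r -mulrBr; exact: nm_mul.
- split.
  + by apply: selfadj_closed => e /yW[z [? _] ?]; exists z.
  + by apply: bicomm_closed => e /yW[z [_ ?] ?]; exists z.
- exists y; split => //.
  rewrite mulrBr mulr1 (yb x (commr_refl _)) -{1}yE addrK//.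
Qed.

End CStar.

(** * Square roots and the closed positive cone *)

Section Positive.
Variables (R : realType) (A : cstarType R).
Implicit Types (a b c x y z h k p q : A) (s t e : R).

Lemma commBl x y z : GRing.comm x z -> GRing.comm y z -> GRing.comm (x - y) z.
Proof.
by move=> xz yz; apply: commDl => //; apply/commC/commrN; exact: commC.
Qed.

Lemma sqrt_one_sub x : star x = x -> nm x < 1 ->
  exists c, [/\ star c = c, nm (1 - c) <= nm x, bicomm x c & c * c = 1 - x].
Proof.
move=> xx x1; have [y [yy yx yb yE]] := sqrt_sub1 xx x1; exists (1 - y); split.
- by rewrite starB star1 yy.
- by rewrite subKr.
- by move=> z xz; apply: commBl; [exact: comm1l|exact: yb].
- have -> : x = y + y - y * y by rewrite yE addrK.
  rewrite mulrBl mul1r mulrBr mulr1; zmod.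
Qed.

(* For self-adjoint h this says that the spectrum is nonnegative; stated with *)
(* the norm it makes the cone property immediate and is weak* closed on balls. *)
Definition pos h := star h = h /\ exists t, nm (sc A t - h) <= t.

Lemma pos_selfadj h : pos h -> star h = h.
Proof. by case. Qed.

Lemma posD h k : pos h -> pos k -> pos (h + k).
Proof.
move=> [hh [t ht]] [kk [s ks]]; split; first by rewrite starD hh kk.
by exists (t + s); rewrite scD opprD addrACA (le_trans (nmD _ _))// lerD.
Qed.

Lemma posZ t h : 0 <= t -> pos h -> pos (t%:C *: h).
Proof.
move=> t0 [hh [s hs]]; split; first by rewrite starZr hh.
by exists (t * s); rewrite -sc_mul -scalerBr nmZr ger0_norm// ler_wpM2l.
Qed.

Lemma pos_sc t : 0 <= t -> pos (sc A t).
Proof.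
by move=> t0; split; [exact: star_sc|exists t; rewrite subrr nm0].
Qed.

(** Adding e makes the ball condition strict: with s = t + e one has h + e = s (1 - (t - h) / s) and
    |t - h| < s, so [sqrt_one_sub] applies. *)
Lemma pos_sqrt h e : pos h -> 0 < e ->
  exists k, [/\ pos k, bicomm h k & k * k = h + sc A e].
Proof.
move=> [hh [t ht]] e0; have t0 : 0 <= t by exact: le_trans (nm_ge0 _) ht.
have s0 : 0 < t + e by rewrite ltr_wpDl.
set s := t + e in s0; have s1 : 0 <= s^-1 by rewrite invr_ge0 ltW.
have [||c [cc c1 cb cE]] := @sqrt_one_sub ((s^-1)%:C *: (sc A t - h)).
- by rewrite starZr starB star_sc hh.
- rewrite nmZr ger0_norm// mulrC ltr_pdivrMr// mul1r (le_lt_trans ht)//.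
  by rewrite ltrDl.
exists ((Num.sqrt s)%:C *: c); split.
- apply: posZ; first exact: sqrtr_ge0.
  split=> //; exists 1; rewrite sc1 (le_trans c1)// nmZr ger0_norm// mulrC.
  by rewrite ler_pdivrMr// mul1r (le_trans ht)// lerDl ltW.
- move=> z hz; apply: commZ; apply: cb; apply: commZ; apply: commBl => //.
  exact: scC.
- rewrite -scalAl -scalAr scalerA -rmorphM/= -expr2 sqr_sqrtr ?ltW// cE.
  rewrite scalerBr scalerA -rmorphM/= divff ?gt_eqF// scale1r opprB addrCA.
  by rewrite scE /s scD; zmod.
Qed.

Lemma conjc_i : conjc 'i = - 'i :> R[i].
Proof. by apply/eqP; rewrite eq_complex/= oppr0 !eqxx. Qed.

Lemma nm_re_le a b : star a = a -> star b = b -> nm a <= nm (a + 'i *: b).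
Proof.
move=> aa bb; set z := a + _.
have -> : a = (2^-1 : R)%:C *: (z + star z).
  rewrite /z starD starZ aa bb addrACA -scalerDl.
  rewrite conjc_i subrr scale0r addr0 scalerDr -scalerDl -rmorphD/= (_ : _ + _ = 1) ?scale1r//.
  by lra.
rewrite nmZr ger0_norm ?invr_ge0// mulrC ler_pdivrMr// mulr_natr mulr2n.
by rewrite (le_trans (nmD _ _))// nm_star.
Qed.

Lemma nm_im_le a b : star a = a -> star b = b -> nm b <= nm (a + 'i *: b).
Proof.
move=> aa bb; set z := a + _.
have -> : nm z = nm (b + 'i *: (- a)).
  have -> : b + 'i *: - a = (- 'i) *: z.
    rewrite /z scalerDr scalerA mulNr -(expr2 'i) sqrCi opprK scale1r scalerN addrC.
    by rewrite scaleNr.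
  by rewrite nmZ nmN nm_i mul1r.
by apply: nm_re_le => //; rewrite starN aa.
Qed.

Lemma nm_normal_sqr a b : star a = a -> star b = b -> GRing.comm a b ->
  nm (a + 'i *: b) ^+ 2 = nm (a * a + b * b).
Proof.
move=> aa bb ab; rewrite -nm_star_mul starD starZ aa bb.
rewrite mulrDl !mulrDr -!scalAl -!scalAr scalerA ab.
rewrite conjc_i scaleNr mulNr -(expr2 'i) sqrCi opprK scale1r.
by congr nm; zmod.
Qed.

(** By [nm_normal_sqr] the right-hand side is |a + i b|^2, and a is the real part of a + i b. The
    order theory starts from this monotonicity of the norm. *)
Lemma nm_sqr_le a b : star a = a -> star b = b -> GRing.comm a b ->
  nm a ^+ 2 <= nm (a * a + b * b).
Proof.
move=> aa bb ab; rewrite -nm_normal_sqr//.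
by rewrite ler_pXn2r ?nnegrE ?nm_ge0//; exact: nm_re_le.
Qed.

(** With l = k / s and c^2 = 1 - l^2 the difference is s^2 c^2, and [nm_sqr_le] bounds |c|^2 by |c^2
    + l^2| = |1|. *)
Lemma nm_sub_sqr k s : star k = k -> nm k < s ->
  nm (sc A (s ^+ 2) - k * k) <= s ^+ 2.
Proof.
move=> kk ks; have s0 : 0 < s by exact: le_lt_trans (nm_ge0 _) ks.
pose l := (s^-1)%:C *: k.
have ll : star l = l by rewrite starZr kk.
have l1 : nm l < 1 by rewrite nmZr gtr0_norm ?invr_gt0// mulrC ltr_pdivrMr ?mul1r.
have [||c [cc c1 cb cE]] := @sqrt_one_sub (l * l).
- by rewrite starM ll.
- by rewrite nm_sqr// expr2 mulr_ilt1 ?nm_ge0.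
have -> : sc A (s ^+ 2) - k * k = (s ^+ 2)%:C *: (c * c).
  rewrite cE scalerBr scE /l -scalAl -scalAr !scalerA -!rmorphM/=.
  by rewrite -invfM -expr2 divff ?scale1r// expf_neq0 ?gt_eqF.
rewrite nmZr ger0_norm ?sqr_ge0// ler_piMr ?sqr_ge0// nm_sqr//.
apply: le_trans (nm_sqr_le cc ll _) _; last by rewrite cE subrK nm_one.
by apply: cb; exact: commMl.
Qed.

Lemma pos_sqr k : star k = k -> pos (k * k).
Proof.
move=> kk; split; first by rewrite starM kk.
by exists ((nm k + 1) ^+ 2); apply: nm_sub_sqr; rewrite ?ltrDl.
Qed.

(** Up to a small multiple of 1, h is a square, to which [nm_sub_sqr] applies. A radius that depends
    only on a bound of |h| is what makes positivity survive limits. *)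
Lemma pos_nm_sub h t : pos h -> nm h <= t -> nm (sc A t - h) <= t.
Proof.
move=> hp ht; apply/ler_addgt0Pl => e e0.
have t0 : 0 <= t by exact: le_trans (nm_ge0 _) ht.
have e2 : 0 < e / 2 by rewrite divr_gt0.
have e4 : 0 < e / 4 by rewrite divr_gt0.
have [k [kp _ kE]] := pos_sqrt hp e4.
have s0 : 0 < t + e / 2 by rewrite ltr_wpDl.
have := @nm_sub_sqr k (Num.sqrt (t + e / 2)) (pos_selfadj kp).
rewrite sqr_sqrtr; last exact: ltW.
have ks : nm k < Num.sqrt (t + e / 2).
  rewrite -(@ltr_pXn2r _ 2)// ?nnegrE ?nm_ge0 ?sqrtr_ge0// sqr_sqrtr; last exact: ltW.
  rewrite -nm_sqr ?(pos_selfadj kp)// kE (le_lt_trans (nmD _ _))//.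
  have := nm_sc A (e / 4); rewrite gtr0_norm// => h4; lra.
move=> /(_ ks); rewrite kE => h1.
have -> : sc A t - h = (sc A (t + e / 2) - (h + sc A (e / 4))) - sc A (e / 4).
  by rewrite (_ : e / 2 = e / 4 + e / 4) ?scD; [zmod|lra].
rewrite (le_trans (nmDB _ _))//.
have := nm_sc A (e / 4); rewrite gtr0_norm// => h4; lra.
Qed.

Lemma pos_closed h : (forall e, 0 < e -> exists2 z, pos z & nm (h - z) < e) ->
  pos h.
Proof.
move=> hW; split.
  by apply: selfadj_closed => e /hW[z [? _] ?]; exists z.
exists (nm h + 1); apply/ler_addgt0Pl => e e0.
have [|z zp] := hW (Num.min e 1); first by rewrite lt_min e0 ltr01.
rewrite lt_min => /andP[hz1 hz2].
have -> : sc A (nm h + 1) - h = (sc A (nm h + 1) - z) - (h - z) by zmod.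
rewrite (le_trans (nmDB _ _))// addrC lerD//; first exact: ltW.
apply: pos_nm_sub => //; rewrite (le_trans (nm_le_dist z h))// lerD2l.
by rewrite nmB ltW.
Qed.

End Positive.

(** * Products, order bounds and inverses *)

Section PositiveCone.
Variables (R : realType) (A : cstarType R).
Implicit Types (a b c x y z h k p q : A) (s t e : R).

(** Up to small shifts h and k are squares of h' and k', which commute since they lie in the double
    commutants, and h'^2 k'^2 = (h' k')^2. *)
Lemma pos_mul h k : pos h -> pos k -> GRing.comm h k -> pos (h * k).
Proof.
move=> hp kp hk; apply: pos_closed => e e0.
pose C := nm h + nm k + 1.
have C0 : 0 < C by rewrite /C ltr_wpDl// addr_ge0 ?nm_ge0.
pose d := Num.min 1 (e / 2 / C).
have d0 : 0 < d by rewrite lt_min ltr01 !divr_gt0.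
have d1 : d <= 1 by rewrite ge_min lexx.
have dC : d * C <= e / 2 by rewrite -ler_pdivlMr// ge_min lexx orbT.
have [h' [hp' hb hE]] := pos_sqrt hp d0.
have [k' [kp' kb kE]] := pos_sqrt kp d0.
have hk' : GRing.comm h' k' by apply/commC/kb/commC/hb.
exists ((h' * k') * (h' * k')).
  by apply: pos_sqr; rewrite starM !pos_selfadj.
have -> : h' * k' * (h' * k') = h * k + (d%:C *: (h + k) + sc A (d * d)).
  rewrite mulrA -(mulrA h') -hk' mulrA -mulrA hE kE mulrDl !mulrDr Msc !scM.
  by rewrite sc_mul scalerDr; zmod.
rewrite opprD addrA subrr sub0r nmN (le_lt_trans (nmD _ _))//.
rewrite nmZr gtr0_norm//.
have := nm_sc A (d * d); rewrite gtr0_norm ?mulr_gt0// => h1.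
have := nmD h k; rewrite -(ler_pM2l d0) => h2.
have : d * d <= d by rewrite ler_piMr// ltW.
by move: dC; rewrite /C; lra.
Qed.

(** The product (t - h)(t + h) = t^2 - h^2 is positive, hence k^2 up to e, and [nm_sqr_le] gives
    |h|^2 <= |h^2 + k^2| <= t^2 + e. *)
Lemma pos_nm_le t h : 0 <= t -> pos (sc A t - h) -> pos (sc A t + h) ->
  nm h <= t.
Proof.
move=> t0 p1 p2.
have hh : star h = h.
  by have := pos_selfadj p2; rewrite starD star_sc => /addrI.
have p3 : pos ((sc A t - h) * (sc A t + h)).
  apply: pos_mul => //; apply: commBl; first exact: scC.
  by apply: commrD => //; apply/commC/scC.
rewrite -(@ler_pXn2r _ 2)// ?nnegrE ?nm_ge0//.
apply/ler_addgt0Pl => e e0.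
have [k [kp kb kE]] := pos_sqrt p3 e0.
apply: le_trans (nm_sqr_le hh (pos_selfadj kp) _) _.
  apply/commC/kb; apply: commMl; first by apply: commBl => //; exact: scC.
  by apply: commDl => //; exact: scC.
rewrite kE mulrDr !mulrBl !Msc !scM sc_mul.
set X := (X in nm X); have -> : X = sc A (e + t * t).
  by rewrite /X scD; zmod.
by rewrite (le_trans (nm_sc _ _))// ger0_norm ?addr_ge0 ?mulr_ge0// ltW.
Qed.

Lemma pos_scB h : star h = h -> pos (sc A (nm h) - h).
Proof.
by move=> hh; split; [rewrite starB star_sc hh|exists (nm h); rewrite subKr].
Qed.

Lemma pos_scD h : star h = h -> pos (sc A (nm h) + h).
Proof.
by move=> hh; rewrite -(opprK h) nmN; apply: pos_scB; rewrite starN hh.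
Qed.

Lemma pos_nm_mono p q : pos p -> pos (q - p) -> nm p <= nm q.
Proof.
move=> pp qp; have qq : pos q by rewrite -(subrK p q); exact: posD.
apply: pos_nm_le (nm_ge0 _) _ _.
  rewrite (_ : _ - p = (sc A (nm q) - q) + (q - p)); last by zmod.
  by apply: posD => //; apply/pos_scB/pos_selfadj.
by apply: posD => //; apply: pos_sc; exact: nm_ge0.
Qed.

(** The inverse f comes from [inv_sub1] by the scaling of [pos_sqrt]; it is positive because f = (f
    k)^2 for the root k of h + e. *)
Lemma pos_inv h e : pos h -> 0 < e ->
  exists g, [/\ pos g, bicomm h g & g * (h + sc A e) = 1].
Proof.
move=> hp e0; have [hh [t ht]] := hp.
have t0 : 0 <= t by exact: le_trans (nm_ge0 _) ht.
have s0 : 0 < t + e by rewrite ltr_wpDl.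
set s := t + e in s0; have s1 : 0 <= s^-1 by rewrite invr_ge0 ltW.
have [||g [gg gb gE]] := @inv_sub1 R A ((s^-1)%:C *: (sc A t - h)).
- by rewrite starZr starB star_sc hh.
- rewrite nmZr ger0_norm// mulrC ltr_pdivrMr// mul1r (le_lt_trans ht)//.
  by rewrite ltrDl.
pose f := (s^-1)%:C *: g.
have fE : f * (h + sc A e) = 1.
  rewrite /f -scalAl scalAr -[RHS]gE; congr (_ * _).
  have -> : h + sc A e = sc A s - (sc A t - h) by rewrite /s scD; zmod.
  by rewrite scalerBr sc_mul mulVf ?gt_eqF// sc1.
have fb : bicomm h f.
  move=> z hz; apply: commZ; apply: gb; apply: commZ; apply: commBl => //.
  exact: scC.
exists f; split=> //.
have [k [kp kb kE]] := pos_sqrt hp e0.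
have fk : GRing.comm f k by apply/fb/commC/kb.
have ff : star f = f by rewrite /f starZr gg.
have -> : f = (f * k) * (f * k).
  by rewrite mulrA -(mulrA f k f) -fk mulrA -mulrA kE -mulrA fE mulr1.
by apply: pos_sqr; rewrite starM (pos_selfadj kp) ff fk.
Qed.

Lemma nm_exp2 h (k : nat) : star h = h -> nm (h ^+ (2 ^ k)) = nm h ^+ (2 ^ k).
Proof.
move=> hh; have sX n : star (h ^+ n) = h ^+ n.
  by elim: n => [|n ih]; rewrite ?expr0 ?star1// {1}exprS starM ih hh -exprSr.
elim: k => [|k ih]; first by rewrite !expr1.
by rewrite expnS mul2n -addnn !exprD nm_sqr// ih expr2.
Qed.

(** A linear factor cannot make up for a ratio r / q above 1. The exponents are powers of two to
    match [nm_exp2]. *)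
Lemma exp2_growth (r q : R) : 0 <= q ->
  (forall n, r ^+ (2 ^ n) <= (2 ^ n).+1%:R * q ^+ (2 ^ n)) -> r <= q.
Proof.
move=> q0 rq; rewrite leNgt; apply/negP => qr.
move: q0; rewrite le_eqVlt => /orP[/eqP q0|q0].
  by have := rq 0%N; rewrite -q0 !expr1 mulr0 leNgt q0 qr.
pose d := r / q - 1; have d0 : 0 < d by rewrite subr_gt0 ltr_pdivlMr ?mul1r.
have rE : r = (1 + d) * q by rewrite /d addrC subrK divfK ?gt_eqF.
have bern n : 1 + n%:R * d <= (1 + d) ^+ n.
  elim: n => [|n ih]; first by rewrite mul0r addr0 expr0.
  rewrite exprS; have h : 0 <= 1 + d by lra.
  apply: le_trans (ler_wpM2l h ih); rewrite -natr1.
  have : 0 <= n%:R * d * d by rewrite !mulr_ge0 ?ler0n// ltW.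
  by lra.
(* The exponent 2^(n+1) is split into two halves N = 2^n; squaring Bernoulli's bound gives (N d)^2
   <= 2 N + 1 <= 3 N. *)
have key n : (2 ^ n)%:R * d ^+ 2 <= 3.
  have := rq n.+1; rewrite rE exprMn ler_pM2r ?exprn_gt0//.
  rewrite expnS mul2n -addnn exprD -natr1 natrD => h.
  set N := (2 ^ n)%:R in h *; have N1 : 1 <= N :> R by rewrite ler1n expn_gt0.
  have := bern (2 ^ n)%N; rewrite -/N => b.
  have Nd : 0 < N * d by rewrite mulr_gt0// (lt_le_trans ltr01).
  have b2 : (N * d) * (N * d) <= (1 + d) ^+ (2 ^ n) * (1 + d) ^+ (2 ^ n).
    by apply: ler_pM; try apply: ltW => //; lra.
  rewrite -(@ler_pM2l _ N) ?(lt_le_trans ltr01)// expr2.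
  have -> : N * (N * (d * d)) = N * d * (N * d) by ring.
  by lra.
have [n dn] : exists n, 3 / d ^+ 2 < n%:R.
  by exists (Num.bound (3 / d ^+ 2)); rewrite archi_boundP// divr_ge0// sqr_ge0.
have := key n; rewrite -ler_pdivlMr ?exprn_gt0// => h.
have /le_lt_trans/(_ dn) := h; rewrite ltr_nat ltnNge.
by rewrite ltnW// ltn_expl.
Qed.

End PositiveCone.

(** * Positivity of the elements [star b * b] *)

Section StarSquare.
Variables (R : realType) (A : cstarType R).
Implicit Types (a b c x y z h k p q : A) (s t e : R).

(* With M = |c|^2, the shifted elements W = c*c + M and Y = cc* + M satisfy    *)
(* c W = Y c, so the powers of Y grow no faster than (n + 1) (M + t)^n.       *)
Lemma pos_star_mulC c t : 0 <= t ->
  pos (sc A t - star c * c) -> pos (sc A t - c * star c).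
Proof.
move=> t0 [ww wp]; pose M := nm c ^+ 2; have M0 : 0 <= M by exact: sqr_ge0.
pose W := star c * c + sc A M; pose Y := c * star c + sc A M.
have ccs : star (c * star c) = c * star c by rewrite starM starK.
have YY : star Y = Y by rewrite starD ccs star_sc.
have cW n : c * W ^+ n = Y ^+ n * c.
  elim: n => [|n ih]; first by rewrite !expr0 mulr1 mul1r.
  rewrite exprS mulrA (_ : c * W = Y * c); last first.
    by rewrite /W /Y mulrDr mulrDl mulrA Msc scM.
  by rewrite -mulrA ih mulrA -exprS.
have W1 : nm W <= M + t.
  have -> : W = sc A (M + t) - (sc A t - star c * c) by rewrite scD /W; zmod.
  apply: pos_nm_sub; first by split.
  rewrite (le_trans (nmDB _ _))// nm_star_mul addrC lerD2l.
  by rewrite (le_trans (nm_sc _ _))// ger0_norm.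
have Wn n : nm (W ^+ n) <= (M + t) ^+ n.
  elim: n => [|n ih]; first by rewrite !expr0 nm_one.
  by rewrite !exprS (le_trans (nm_mul _ _))// ler_pM ?nm_ge0.
have Yn n : nm (Y ^+ n) <= n.+1%:R * (M + t) ^+ n.
  elim: n => [|n ih]; first by rewrite !expr0 mul1r nm_one.
  rewrite exprSr {2}/Y mulrDr Msc mulrA -cW.
  rewrite (le_trans (nmD _ _))// nmZr ger0_norm//.
  have h1 : nm (c * W ^+ n * star c) <= M * (M + t) ^+ n.
    rewrite (le_trans (nm_mul _ _))// nm_star /M expr2 mulrAC ler_wpM2r ?nm_ge0//.
    by rewrite (le_trans (nm_mul _ _))// ler_wpM2l ?nm_ge0.
  have h2 := ler_wpM2l M0 ih.
  rewrite (le_trans (lerD h1 h2))// exprSr -[n.+2%:R]natr1 mulrDl mul1r.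
  have h3 : 0 <= (M + t) ^+ n by rewrite exprn_ge0// addr_ge0.
  have h4 : 0 <= t * (M + t) ^+ n by rewrite mulr_ge0.
  have h5 : 0 <= n.+1%:R * (t * (M + t) ^+ n) by rewrite mulr_ge0.
  by move: h3 h4 h5; set X := (M + t) ^+ n; set N := n.+1%:R; lra.
have YM : nm Y <= M + t.
  apply: exp2_growth; first by rewrite addr_ge0.
  by move=> n; rewrite -nm_exp2.
split; first by rewrite starB star_sc ccs.
exists (M + t); rewrite (_ : _ - _ = Y)//.
by rewrite scD /Y; zmod.
Qed.

Lemma half_scale x : (2^-1 : R)%:C *: (x + x) = x.
Proof.
by rewrite scalerDr -scalerDl -rmorphD/= (_ : _ + _ = 1) ?scale1r//; lra.
Qed.

Lemma re_im_decomp x :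
  exists k l, [/\ star k = k, star l = l & x = k + 'i *: l].
Proof.
exists ((2^-1 : R)%:C *: (x + star x)).
exists ((2^-1 : R)%:C *: ('i *: (star x - x))); split.
- by rewrite starZr starD starK addrC.
- by rewrite starZr starZ conjc_i starB starK scaleNr -scalerN opprB.
- rewrite [X in _ + X]scalerA mulrC -scalerA (scalerA 'i) -(expr2 'i) sqrCi.
  by rewrite scaleN1r -scalerDr (_ : _ - _ = x + x) ?half_scale//; zmod.
Qed.

(** This is half the sum of the squares of the self-adjoint elements u = c + star c and v = i (star
    c - c). *)
Lemma pos_star_mulD c : pos (star c * c + c * star c).
Proof.
pose u := c + star c; pose v := 'i *: (star c - c).
have uu : star u = u by rewrite starD starK addrC.
have vv : star v = v by rewrite starZ conjc_i starB starK scaleNr -scalerN opprB.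
rewrite -[X in pos X]half_scale (_ : _ + _ + (_ + _) = u * u + v * v).
  by apply: posZ; [rewrite invr_ge0|apply: posD; exact: pos_sqr].
rewrite /v -scalAl -scalAr scalerA -(expr2 'i) sqrCi scaleN1r /u.
by rewrite !mulrDl !mulrDr !mulNr !mulrN; zmod.
Qed.

(* Kelley-Vaught. With x = b*b and m = sqrt (x^2 + e), the element n = m - x  *)
(* approximates twice the negative part of x, and c = bn has c*c <= e n. Then *)
(* cc* is squeezed between multiples of e, so n^3 = O(e).                     *)
Lemma pos_star_mul b : pos (star b * b).
Proof.
set x := star b * b; have xx : star x = x by rewrite starM starK.
pose C := nm x *+ 2 + 1; have x0 := nm_ge0 x.
have C0 : 0 < C by rewrite /C; lra.
apply: pos_closed => eta eta0.
pose th := Num.min eta 1 / 2.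
have th0 : 0 < th by rewrite divr_gt0// lt_min eta0 ltr01.
have th1 : th < 1 by rewrite ltr_pdivrMr// gt_min; apply/orP; right; lra.
have the : th < eta.
  rewrite ltr_pdivrMr// gt_min; apply/orP; left; lra.
(* Chosen so that 4 e C = th^3, the bound reached below for |n^3|. *)
pose e := th ^+ 3 / (C *+ 4).
have C4 : 0 < C *+ 4 by rewrite pmulrn_lgt0.
have e0 : 0 < e by rewrite divr_gt0// exprn_gt0.
have e1 : e <= 1.
  rewrite ler_pdivrMr// mul1r (@le_trans _ _ 1)//; last by rewrite /C; lra.
  by rewrite exprn_ile1// ltW.
have [m [mp mb mE]] := pos_sqrt (pos_sqr xx) e0.
have [g [gp gb gE]] := pos_inv (pos_sqr xx) e0.
have mm := pos_selfadj mp.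
have xm : GRing.comm m x by apply: mb; exact: commMl.
have gm : GRing.comm g m by apply: gb; apply/commC/mb/commr_refl.
have gx : GRing.comm g x by apply: gb; apply: commMl.
have mx2 : (m - x) * (m + x) = sc A e.
  by rewrite mulrBl !mulrDr mE xm; zmod.
(* As g is inverse to m^2 = x^2 + e, the equation says y = g m (y^2 + e) / 2, a product of commuting
   positive elements. It holds for m - x and m + x because their product is e. *)
have sq_half y : star y = y -> GRing.comm m y -> GRing.comm g y ->
    m * (y * y + sc A e) = m * m * (y + y) -> pos y.
  move=> yy my gy yE.
  have -> : y = (2^-1 : R)%:C *: (g * (m * (y * y + sc A e))).
    by rewrite yE mulrA mE gE mul1r half_scale.
  apply: posZ; first by rewrite invr_ge0.
  have ysc : pos (y * y + sc A e).
    by apply: posD; [exact: pos_sqr|apply: pos_sc; exact: ltW].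
  have cyy z : GRing.comm z y -> GRing.comm z (y * y + sc A e).
    by move=> zy; apply: commrD; [exact: commrM|apply/commC/scC].
  apply: pos_mul => //; last by apply: commrM => //; exact: cyy.
  by apply: pos_mul => //; exact: cyy.
pose n := m - x.
have np : pos n.
  apply: sq_half; rewrite ?starB ?mm ?xx//.
  - by apply: commrB.
  - by apply: commrB.
  - rewrite -mulrA; congr (m * _); rewrite /n -mx2 !(mulrDl, mulrDr, mulNr, mulrN) !xm; zmod.
have bp : pos (m + x).
  apply: sq_half; rewrite ?starD ?mm ?xx//.
  - by apply: commrD.
  - by apply: commrD.
  - rewrite -mulrA; congr (m * _); rewrite -mx2 !(mulrDl, mulrDr, mulNr, mulrN) !xm; zmod.
have nn := pos_selfadj np.
have mn : GRing.comm m n by apply: commrB.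
have nb : GRing.comm (m + x) n by apply: commDl => //; apply: commrB.
have mC : nm m <= nm x + 1.
  rewrite -(@ler_pXn2r _ 2)// ?nnegrE ?nm_ge0 ?addr_ge0// -nm_sqr// mE.
  rewrite (le_trans (nmD _ _))// nm_sqr//; have := nm_sc A e.
  rewrite gtr0_norm// sqrrD mulr1 expr1n; lra.
have nC : nm n <= C by rewrite (le_trans (nmDB _ _))// /C mulr2n; lra.
have mnn : pos (m * (n * n)).
  by apply: pos_mul => //; [exact: pos_sqr|exact: commrM].
pose c := b * n.
have cE : star c * c = e%:C *: n - m * (n * n).
  rewrite /c starM nn -!mulrA (mulrA (star b)) -/x.
  rewrite (_ : x * n = sc A e - m * n); last first.
    by rewrite -mx2 -/n -nb mulrDl; zmod.
  by rewrite mulrBr Msc (mulrA n m) -mn mulrA.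
have eC : pos (sc A (e * C) - e%:C *: n).
  rewrite -sc_mul -scalerBr; apply: posZ; first exact: ltW.
  rewrite (_ : _ - n = sc A (C - nm n) + (sc A (nm n) - n)).
    by apply: posD; [apply: pos_sc; rewrite subr_ge0|exact: pos_scB].
  by rewrite scB; zmod.
have eC0 : 0 <= e * C by rewrite mulr_ge0// ltW.
(* Above, [star c * c] <= e n <= e C transfers to [c * star c] by [pos_star_mulC]; below,
   [c * star c] >= - [star c * c] >= - e C by [pos_star_mulD]. *)
have cs : nm (c * star c) <= e * C.
  apply: pos_nm_le => //.
    apply: pos_star_mulC => //.
    rewrite cE (_ : _ - _ = (sc A (e * C) - e%:C *: n) + m * (n * n)); last by zmod.
    exact: posD.
  rewrite (_ : _ + _ = (star c * c + c * star c) +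
    ((sc A (e * C) - e%:C *: n) + m * (n * n))); last by rewrite cE; zmod.
  by apply: posD; [exact: pos_star_mulD|exact: posD].
have mnn1 : nm (m * (n * n)) <= (e * C) *+ 2.
  have -> : m * (n * n) = e%:C *: n - star c * c by rewrite cE; zmod.
  rewrite (le_trans (nmDB _ _))// mulr2n lerD//.
    by rewrite nmZr gtr0_norm// ler_wpM2l// ltW.
  rewrite nm_star_mul -(nm_star c) -nm_star_mul starK//.
(* Since 2 m - n = m + x is positive, n^3 <= 2 m n^2 in the order, hence in norm. *)
have n3 : nm (n * (n * n)) <= (e * C) *+ 4.
  have n3p : pos (n * (n * n)) by apply: pos_mul => //; [exact: pos_sqr|exact: commrM].
  have := @pos_nm_mono _ _ (n * (n * n)) (m * (n * n) + m * (n * n)) n3p.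
  rewrite (_ : _ - _ = (m + x) * (n * n)); last first.
    by rewrite -mulrDl -mulrBl; congr (_ * _); rewrite /n; zmod.
  have b2 : pos ((m + x) * (n * n)).
    by apply: pos_mul => //; [exact: pos_sqr|exact: commrM].
  move=> /(_ b2)/le_trans; apply.
  by rewrite (le_trans (nmD _ _))//; move: mnn1; lra.
(* The C*-identity gives |n|^4 = |n^4|, which is at most |n^3| |n|. *)
have n3' : nm n ^+ 3 <= th ^+ 3.
  have h4 : nm n ^+ 4 <= (th ^+ 3) * nm n.
    rewrite (_ : nm n ^+ 4 = nm (n * (n * (n * n)))).
      rewrite (le_trans (nm_mul _ _))// mulrC ler_wpM2r ?nm_ge0//.
      by rewrite (le_trans n3)// /e -mulrnAr divfK// gt_eqF.
    have -> : n * (n * (n * n)) = (n * n) * (n * n) by rewrite !mulrA.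
    by rewrite nm_sqr ?starM ?nn// nm_sqr// -exprM.
  have := nm_ge0 n; rewrite le_eqVlt => /orP[/eqP<-|n_gt0].
    by rewrite expr0n exprn_ge0// ltW.
  by move: h4; rewrite exprSr ler_pM2r.
exists m => //; rewrite -nmB -/n (le_lt_trans _ the)//.
by rewrite -(@ler_pXn2r _ 3)// ?nnegrE ?nm_ge0// ltW.
Qed.

End StarSquare.

(** * Weak* limits along ultrafilters *)

Lemma ultra_bounded_cvg (R : realType) (T : Type) (U : set_system T)
    (UU : UltraFilter U) (r : T -> R) (M : R) :
  U [set t | `|r t| <= M] -> exists l : R, r @ U --> l.
Proof.
move=> rM; have [|l [_ lc]] := @segment_compact R (- M) M (r @ U) _.
  by apply: (@filterS _ U _ _ _ _ rM) => t /=; rewrite in_itv/= ler_norml.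
exists l => N Nl; have [//|NC] := @in_ultra_setVsetC _ _ (r @^-1` N) UU.
by have [x [/=]] := lc (~` N) N NC Nl.
Qed.

Section Pairing.
Variables (R : realType) (A : wstarType R).
Implicit Types (a b : A) (phi psi : predual A).

Lemma pairingDr a phi psi :
  pairing a (phi + psi) = pairing a phi + pairing a psi.
Proof. by have := pairingDZr a 1 phi psi; rewrite scale1r mul1r. Qed.

Lemma pairing0r a : pairing a (0 : predual A) = 0.
Proof. by apply/(addrI (pairing a 0)); rewrite -pairingDr !addr0. Qed.

Lemma pairingZr a (c : R[i]) phi : pairing a (c *: phi) = c * pairing a phi.
Proof. by have := pairingDZr a c phi 0; rewrite pairing0r !addr0. Qed.

Lemma pairingBr a phi psi :
  pairing a (phi - psi) = pairing a phi - pairing a psi.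
Proof. by rewrite pairingDr -scaleN1r pairingZr mulN1r. Qed.

Lemma pairingDl a b phi : pairing (a + b) phi = pairing a phi + pairing b phi.
Proof. by have := pairingDZl 1 a b phi; rewrite scale1r mul1r. Qed.

Lemma pairing0l phi : pairing (0 : A) phi = 0.
Proof. by apply/(addrI (pairing 0 phi)); rewrite -pairingDl !addr0. Qed.

Lemma pairingZl a (c : R[i]) phi : pairing (c *: a) phi = c * pairing a phi.
Proof. by have := pairingDZl c a 0 phi; rewrite pairing0l !addr0. Qed.

Lemma pairingNl a phi : pairing (- a) phi = - pairing a phi.
Proof. by rewrite -scaleN1r pairingZl mulN1r. Qed.

Lemma pairingBl a b phi : pairing (a - b) phi = pairing a phi - pairing b phi.
Proof. by rewrite pairingDl pairingNl. Qed.

Lemma nm_pairing a phi : nm (pairing a phi) <= nm a * nm phi.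
Proof.
have [_ h _] := pairing_isometry a.
by have := h phi; rewrite !nmE -rmorphM/= lecR.
Qed.

Lemma nm_pairing_le a (B : R) : 0 <= B ->
  (forall phi, nm (pairing a phi) <= B * nm phi) -> nm a <= B.
Proof.
move=> B0 aB; have [_ _ h] := pairing_isometry a.
have := h B%:C; rewrite nmE !lecR; apply => // phi.
by rewrite !nmE -rmorphM/= lecR.
Qed.

Lemma nm_conjc (z : R[i]) : conjc z * z = (nm z ^+ 2)%:C.
Proof. by rewrite rmorphXn/= -nmE sqr_normc mulrC. Qed.

(** A scalar multiple of phi has norm 1 and a nonnegative real pairing with a, so real parts on the
    unit ball determine the norm. *)
Lemma nm_pairing_Re_le a (B : R) :
  (forall phi, nm phi <= 1 -> complex.Re (pairing a phi) <= B) -> nm a <= B.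
Proof.
move=> aB; have B0 : 0 <= B by have := aB 0; rewrite nm0 pairing0r; apply.
apply: nm_pairing_le => // phi.
have [z0|z0] := eqVneq (nm (pairing a phi)) 0.
  by rewrite z0 mulr_ge0// nm_ge0.
have z_gt0 : 0 < nm (pairing a phi) by rewrite lt_neqAle eq_sym z0 nm_ge0.
have phi_gt0 : 0 < nm phi.
  rewrite lt_neqAle nm_ge0 andbT eq_sym; apply: contra z0 => /eqP p0.
  by rewrite eq_le nm_ge0 andbT (le_trans (nm_pairing _ _))// p0 mulr0.
set z := pairing a phi in z0 z_gt0 *.
pose k := (nm z)^-1 * (nm phi)^-1.
have k0 : 0 < k by rewrite mulr_gt0 ?invr_gt0.
have := aB ((conjc z * k%:C) *: phi).
rewrite nmZ nmM nm_real pairingZr -/z [_ * k%:C * z]mulrAC nm_conjc -rmorphM/=.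
have -> : nm (conjc z) = nm z by rewrite /nm norm_conjc.
have p0 : nm phi != 0 by rewrite gt_eqF.
rewrite gtr0_norm// (_ : nm z * k * nm phi = 1); last by rewrite /k; field; rewrite ?p0 ?z0.
rewrite (_ : _ * k = nm z / nm phi); last by rewrite /k; field; rewrite ?p0 ?z0.
by move=> /(_ (lexx 1)) /=; rewrite ler_pdivrMr.
Qed.

Lemma Im_Re (z : R[i]) : complex.Im z = complex.Re (- 'i * z).
Proof. by case: z => u v /=; ring. Qed.

(* Convergence in the weak* topology: imaginary parts are the real parts of   *)
(* the pairing with [- 'i *: phi].                                            *)
Definition wcvg (T : Type) (U : set_system T) (g : T -> A) a :=
  forall phi, complex.Re (pairing (g t) phi) @[t --> U] -->
    complex.Re (pairing a phi).

Lemma Re_pairing_le a phi (M : R) : nm a <= M ->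
  `|complex.Re (pairing a phi)| <= M * nm phi.
Proof.
move=> aM; rewrite (le_trans (normRe_nm _))// (le_trans (nm_pairing _ _))//.
by rewrite ler_wpM2r ?nm_ge0.
Qed.

Section Filter.
Variables (T : Type) (U : set_system T).
Context {UP : ProperFilter U}.
Implicit Types (g h : T -> A) (M : R).

Lemma wcvgD g h a b : wcvg U g a -> wcvg U h b ->
  wcvg U (fun t => g t + h t) (a + b).
Proof.
move=> ga hb phi; rewrite pairingDl raddfD/=.
under eq_fun do rewrite pairingDl raddfD/=.
by apply: cvgD; [exact: ga|exact: hb].
Qed.

Lemma wcvgZ (c : R[i]) g a : wcvg U g a ->
  wcvg U (fun t => c *: g t) (c *: a).
Proof.
move=> ga phi; rewrite pairingZl -pairingZr.
by under eq_fun do rewrite pairingZl -pairingZr; exact: ga.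
Qed.

Lemma wcvg_cst a : wcvg U (fun=> a) a.
Proof. by move=> phi; exact: cvg_cst. Qed.

Lemma wcvgN g a : wcvg U g a -> wcvg U (fun t => - g t) (- a).
Proof.
move=> ga; have := @wcvgZ (-1) _ _ ga; rewrite scaleN1r.
by under eq_fun do rewrite scaleN1r.
Qed.

Lemma wcvg_nm_le g a M : wcvg U g a -> U [set t | nm (g t) <= M] -> nm a <= M.
Proof.
move=> ga gM.
have M0 : 0 <= M.
  by have [t /= tM] := filter_ex gM; exact: le_trans (nm_ge0 _) tM.
apply: nm_pairing_Re_le => phi p1; apply: cvgr_to_le (ga phi) _.
apply: filterS gM => t /= /(Re_pairing_le phi) h.
by rewrite (le_trans (ler_norm _))// (le_trans h)// ler_piMr.
Qed.

(* If a = k + i l is a limit of self-adjoint elements of norm at most M, then *)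
(* |l + s|^2 <= M^2 + s^2 for all real s, which forces l = 0 as |s| grows.     *)
Lemma wcvg_selfadj g a M : wcvg U g a ->
  U [set t | star (g t) = g t /\ nm (g t) <= M] -> star a = a.
Proof.
move=> ga gM.
have M0 : 0 <= M.
  by have [t /= [_ tM]] := filter_ex gM; exact: le_trans (nm_ge0 _) tM.
have [k [l [kk ll aE]]] := re_im_decomp a.
have aI (s : R) : nm (l + sc A s) ^+ 2 <= M ^+ 2 + s ^+ 2.
  have h : nm (a + 'i *: sc A s) <= Num.sqrt (M ^+ 2 + s ^+ 2).
    apply: (@wcvg_nm_le (fun t => g t + 'i *: sc A s)).
      by apply: wcvgD => //; exact: wcvg_cst.
    apply: filterS gM => t /= [gg gM].
    rewrite -(@ler_pXn2r _ 2)// ?nnegrE ?nm_ge0 ?sqrtr_ge0//.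
    rewrite sqr_sqrtr ?addr_ge0 ?sqr_ge0// nm_normal_sqr ?star_sc//; last first.
      by apply/commC/scC.
    rewrite (le_trans (nmD _ _))// nm_sqr// nm_sqr ?star_sc// lerD//.
      by rewrite ler_pXn2r ?nnegrE ?nm_ge0.
    by rewrite -(real_normK (num_real s)) ler_pXn2r ?nnegrE ?nm_ge0// nm_sc.
  rewrite -(@sqr_sqrtr _ (M ^+ 2 + s ^+ 2)) ?addr_ge0 ?sqr_ge0//.
  rewrite ler_pXn2r ?nnegrE ?nm_ge0 ?sqrtr_ge0// (le_trans _ h)//.
  by rewrite {1}aE -addrA -scalerDr nm_im_le// starD ll star_sc.
have lI (s : R) : 0 < s -> nm l <= M ^+ 2 / s.
  (* With this eta, (s + eta)^2 >= M^2 + s^2, so |l + s| and |l - s| are at most s + eta. By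
     definition of [pos] with radius s + eta, both eta - l and eta + l are positive. *)
  move=> s0; pose eta := M ^+ 2 / s.
  have e0 : 0 <= eta by rewrite divr_ge0 ?sqr_ge0// ltW.
  have bd (x : A) : nm x ^+ 2 <= M ^+ 2 + s ^+ 2 -> nm x <= s + eta.
    move=> /le_trans h; rewrite -(@ler_pXn2r _ 2)// ?nnegrE ?nm_ge0//.
      apply: h; rewrite sqrrD.
      have -> : M ^+ 2 = s * eta by rewrite /eta mulrC divfK// gt_eqF.
      rewrite mulr2n.
      have : 0 <= s * eta by rewrite mulr_ge0// ltW.
      have : 0 <= eta ^+ 2 by rewrite sqr_ge0.
      lra.
    by rewrite addr_ge0// ltW.
  apply: pos_nm_le => //.
    split; first by rewrite starB ll star_sc.
    exists (s + eta); rewrite (_ : _ - _ = l + sc A s); last by rewrite scD; zmod.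
    by apply: (bd (l + sc A s)); exact: aI.
  split; first by rewrite starD ll star_sc.
  exists (s + eta).
  rewrite (_ : _ - _ = - (l + sc A (- s))); last by rewrite scN scD; zmod.
  by rewrite nmN; apply: bd; rewrite -[s ^+ 2]sqrrN; exact: aI.
have l0 : l = 0.
  apply/nm0_eq0/eqP; rewrite eq_le nm_ge0 andbT; apply/ler_addgt0Pl => e e0.
  rewrite addr0; have s0 : 0 < (M ^+ 2 + 1) / e.
    by rewrite divr_gt0// ltr_wpDl// sqr_ge0.
  apply: le_trans (lI _ s0) _; rewrite invf_div mulrA ler_pdivrMr; last first.
    by rewrite ltr_wpDl// sqr_ge0.
  by rewrite mulrC ler_wpM2l ?(ltW e0)// lerDl.
by rewrite aE l0 scaler0 addr0.
Qed.

(** By [pos_nm_sub] the radius M witnesses positivity of all [g t] at once, and norm bounds pass to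
    weak* limits. *)
Lemma wcvg_pos g a M : wcvg U g a ->
  U [set t | pos (g t) /\ nm (g t) <= M] -> pos a.
Proof.
move=> ga gM; split.
  apply: (@wcvg_selfadj _ _ M ga).
  by apply: filterS gM => t /= [[]].
exists M; apply: (@wcvg_nm_le (fun t => sc A M - g t)).
  by apply: wcvgD; [exact: wcvg_cst|exact: wcvgN].
by apply: filterS gM => t /= [gp gM]; exact: pos_nm_sub.
Qed.

End Filter.

(** Banach-Alaoglu. The limits l of the real parts form a bounded real-linear functional on the
    predual; l(phi) + i l(- i phi) is complex linear, hence represented by an element of A. *)
Lemma wcvg_exists (T : Type) (U : set_system T) (UU : UltraFilter U)
    (g : T -> A) (M : R) :
  U [set t | nm (g t) <= M] -> exists a, wcvg U g a.
Proof.
move=> gM.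
have M0 : 0 <= M.
  by have [t /= tM] := filter_ex gM; exact: le_trans (nm_ge0 _) tM.
have /choice[l gl] phi : exists l : R,
    complex.Re (pairing (g t) phi) @[t --> U] --> l.
  apply: (@ultra_bounded_cvg _ _ _ _ _ (M * nm phi)).
  by apply: filterS gM => t /= /Re_pairing_le.
have lle phi : `|l phi| <= M * nm phi.
  rewrite ler_norml; apply/andP; split.
    apply: cvgr_to_ge (gl phi) _.
    by apply: filterS gM => t /= /(Re_pairing_le phi); rewrite ler_norml => /andP[].
  apply: cvgr_to_le (gl phi) _.
  by apply: filterS gM => t /= /(Re_pairing_le phi); rewrite ler_norml => /andP[].
have lD phi psi : l (phi + psi) = l phi + l psi.
  apply: (cvg_unique (@norm_hausdorff _ _) (gl (phi + psi))).
  by rewrite /=; under eq_fun do rewrite pairingDr raddfD/=; exact: cvgD.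
have lZ (t : R) phi : l (t%:C *: phi) = t * l phi.
  apply: (cvg_unique (@norm_hausdorff _ _) (gl (t%:C *: phi))).
  rewrite /=; under eq_fun => u.
    rewrite pairingZr (_ : complex.Re _ = t * complex.Re (pairing (g u) phi)).
      over.
    by case: (pairing _ _) => x y /=; ring.
  exact: cvgMr.
pose f (phi : predual A) : R[i]^o := (l phi +i* l (- 'i *: phi)).
have [||a fa] := @pairing_onto R A f.
- move=> [x y] phi psi; rewrite /f.
  have cE : x +i* y = x%:C + 'i * y%:C :> R[i] by rewrite [LHS]complexReIm.
  have h1 : - 'i *: ((x%:C + 'i * y%:C) *: phi + psi) =
      x%:C *: (- 'i *: phi) + (y%:C *: phi + - 'i *: psi).
    rewrite scalerDr scalerDl scalerDr !scalerA.
    rewrite mulrA [- 'i * 'i]mulNr -(expr2 'i) sqrCi opprK mul1r.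
    by rewrite [- 'i * _]mulrC addrA.
  have h2 : (x%:C + 'i * y%:C) *: phi + psi =
      x%:C *: phi + ((- y)%:C *: (- 'i *: phi) + psi).
    by rewrite scalerDl rmorphN/= scalerA mulrNN mulrC addrA.
  have fE : l ((x%:C + 'i * y%:C) *: phi + psi) +i*
    l (- 'i *: ((x%:C + 'i * y%:C) *: phi + psi)) =
    (x * l phi - y * l (- 'i *: phi) + l psi) +i*
    (x * l (- 'i *: phi) + y * l phi + l (- 'i *: psi)).
    by rewrite h1 h2 !lD !lZ mulNr !addrA.
  rewrite {1 2}cE fE.
  by apply/eqP; rewrite eq_complex/=; apply/andP; split; apply/eqP; ring.
- exists (M *+ 2)%:C => phi.
  rewrite !nmE -rmorphM/= lecR (le_trans (nm_le_ReIm _))//= mulrnAl mulr2n.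
  rewrite lerD// (le_trans (lle _))// nmZ nmN nm_i mul1r//.
- by exists a => phi; rewrite -fa; exact: gl.
Qed.

End Pairing.

(** * Normal majorants *)

Section Minimax.
Variables (R : realType).

Definition pospart (x : R) := (x + `|x|) / 2.

Lemma pospart_ge0 x : 0 <= pospart x.
Proof. by rewrite divr_ge0// -lerBlDl sub0r -normrN ler_norm. Qed.

Lemma pospart_le0 x : pospart x = 0 -> x <= 0.
Proof. by rewrite /pospart => h; have := normr_ge0 x; lra. Qed.

Lemma pospart_mul x : x * pospart x = pospart x ^+ 2.
Proof.
rewrite /pospart; have [x0|x0] := lerP 0 x.
  by rewrite ger0_norm//; field.
by rewrite ltr0_norm// subrr mul0r mulr0 expr0n.
Qed.

(** The squared positive part has derivative twice the positive part, with a second-order remainder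
    of at most d^2. *)
Lemma pospart_sub x d :
  pospart (x - d) ^+ 2 <= pospart x ^+ 2 - 2 * d * pospart x + d ^+ 2.
Proof.
rewrite /pospart; have [x0|x0] := lerP 0 x; have [y0|y0] := lerP 0 (x - d);
  rewrite ?(ger0_norm x0) ?(ltr0_norm x0) ?(ger0_norm y0) ?(ltr0_norm y0); nra.
Qed.

Lemma pospart_cvg (T : Type) (F : set_system T) {FF : Filter F} (f : T -> R)
  (l : R) : f @ F --> l -> pospart (f t) ^+ 2 @[t --> F] --> pospart l ^+ 2.
Proof.
move=> fl; rewrite /pospart expr2; under eq_fun do rewrite expr2.
have h : (f t + `|f t|) / 2 @[t --> F] --> (l + `|l|) / 2.
  by apply: cvgMl; apply: cvgD => //; exact: cvg_norm.
exact: cvgM.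
Qed.

End Minimax.

(* A Krein-Smulian argument: a functional on the cone Q that is dominated by  *)
(* the norm of alpha is dominated by the real part of a normal functional,    *)
(* as soon as the part of Q lying over the unit ball is weak* compact.        *)
Section KreinSmulian.
Variables (R : realType) (A : wstarType R) (V : lmodType R[i]).
Variables (Q : V -> Prop) (alpha : V -> A) (rho : V -> R).
Implicit Types (u v w : V) (phi psi : predual A) (c t : R).

Hypothesis QD : forall u v, Q u -> Q v -> Q (u + v).
Hypothesis QZ : forall t v, 0 <= t -> Q v -> Q (t%:C *: v).
Hypothesis alphaD : forall u v, alpha (u + v) = alpha u + alpha v.
Hypothesis alphaZ : forall t v, alpha (t%:C *: v) = t%:C *: alpha v.
Hypothesis rhoD : forall u v, rho (u + v) = rho u + rho v.
Hypothesis rhoZ : forall t v, rho (t%:C *: v) = t * rho v.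

(** Positive values are the amount by which phi fails to majorise rho at v. *)
Definition gap phi v := rho v - complex.Re (pairing (alpha v) phi).
Definition slice v := Q v /\ nm (alpha v) <= 1.

Hypothesis cpt : forall U : set_system V, UltraFilter U -> U slice ->
  exists2 v, slice v & forall phi, gap phi u @[u --> U] --> gap phi v.

Lemma gapD phi u v : gap phi (u + v) = gap phi u + gap phi v.
Proof. by rewrite /gap rhoD alphaD pairingDl raddfD/=; ring. Qed.

Lemma Re_realM (t : R) (z : R[i]) : complex.Re (t%:C * z) = t * complex.Re z.
Proof. by case: z => x y /=; ring. Qed.

Lemma gapZ phi t v : gap phi (t%:C *: v) = t * gap phi v.
Proof. by rewrite /gap rhoZ alphaZ pairingZl Re_realM; ring. Qed.

Lemma gapDr phi psi v :
  gap (phi + psi) v = gap phi v - complex.Re (pairing (alpha v) psi).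
Proof. by rewrite /gap pairingDr raddfD/=; ring. Qed.

Definition segm v w t := v + t%:C *: (w - v).

Lemma segmE v w t : segm v w t = (1 - t)%:C *: v + t%:C *: w.
Proof.
rewrite /segm scalerBr rmorphB/= scalerBl scale1r; zmod.
Qed.

Lemma slice_segm v w t : 0 <= t <= 1 -> slice v -> slice w ->
  slice (segm v w t).
Proof.
move=> /andP[t0 t1] [Qv v1] [Qw w1]; have s0 : 0 <= 1 - t by lra.
rewrite segmE; split; first by apply: QD; exact: QZ.
rewrite alphaD !alphaZ (le_trans (nmD _ _))// !nmZr !ger0_norm//.
have := ler_wpM2l s0 v1; have := ler_wpM2l t0 w1; lra.
Qed.

Lemma gap_segm phi v w t :
  gap phi (segm v w t) = gap phi v + t * (gap phi w - gap phi v).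
Proof. by rewrite segmE gapD !gapZ; ring. Qed.

(** V carries no topology, so compactness and continuity are stated along ultrafilters: one that
    contains all sets of near-minimisers converges to a minimiser. *)
Lemma slice_min (f : V -> R) : (forall v, 0 <= f v) -> (exists v, slice v) ->
  (forall (U : set_system V) v, UltraFilter U ->
     (forall phi, gap phi u @[u --> U] --> gap phi v) -> f @ U --> f v) ->
  exists2 v, slice v & forall w, slice w -> f v <= f w.
Proof.
move=> f0 [v0 Sv0] fc; pose I := inf (f @` slice).
have hI : has_inf (f @` slice).
  by split; [exists (f v0), v0|exists 0 => _ [v _ <-]].
pose B (e : R) : set V := [set v | slice v /\ f v <= I + e].
have FF : ProperFilter (filter_from [set e : R | 0 < e] B).
  apply: filter_from_proper; last first.
    move=> e e0; have [_ [v Sv <-] ve] := inf_adherent e0 hI.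
    by exists v; split=> //; exact: ltW.
  apply: filter_from_filter; first by exists 1; exact: ltr01.
  move=> e1 e2 e10 e20; exists (Num.min e1 e2); first by rewrite /= lt_min e10.
  by move=> v [Sv ve]; split; split=> //; rewrite (le_trans ve)// lerD2l ge_min lexx ?orbT.
have [U [UU FU]] := ultraFilterLemma FF.
have US : U slice by apply: FU; exists 1; [exact: ltr01|move=> v []].
have [v Sv vU] := cpt UU US; exists v => // w Sw.
have fI : f v <= I.
  apply/ler_addgt0Pr => e e0; apply: cvgr_to_le (fc _ _ UU vU) _.
  by apply: FU; exists e => // u [].
by rewrite (le_trans fI)//; apply: ge_inf; [exact: hI.2|exists w].
Qed.

(* Minimise the sum of the squared positive parts of delta - gap (phi + psi): *)
(* by the first-order condition, the positive parts at a minimiser are the     *)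
(* weights of a convex combination that would violate the hypothesis.         *)
Lemma finite_minimax (r : seq (predual A)) phi c delta : 0 <= c ->
  all (fun psi => nm psi <= c) r ->
  (forall psi, nm psi <= c -> exists2 v, slice v & delta < gap (phi + psi) v) ->
  exists2 v, slice v &
    forall psi, psi \in r -> delta <= gap (phi + psi) v.
Proof.
move=> c0 /allP rc h.
pose f v := \sum_(psi <- r) pospart (delta - gap (phi + psi) v) ^+ 2.
have [|||v Sv vmin] := @slice_min f.
- by move=> v; apply: sumr_ge0 => psi _; exact: sqr_ge0.
- by have [|v Sv _] := h 0; [rewrite nm0|exists v].
- move=> U v UU vU; rewrite /f.
  elim: (r) => [|psi s ih].
    by under eq_fun do rewrite big_nil; rewrite big_nil; exact: cvg_cst.
  under eq_fun do rewrite big_cons; rewrite big_cons; apply: cvgD => //.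
  by apply: pospart_cvg; apply: cvgB; [exact: cvg_cst|exact: vU].
exists v => //.
pose mu psi := pospart (delta - gap (phi + psi) v).
have mu0 psi : 0 <= mu psi by exact: pospart_ge0.
have [m0|m0] := eqVneq (\sum_(psi <- r) mu psi) 0.
  move=> psi psir; rewrite -subr_le0; apply: pospart_le0; apply/eqP.
  by move/eqP: m0; rewrite psumr_eq0// => /allP/(_ _ psir).
have m_gt0 : 0 < \sum_(psi <- r) mu psi.
  by rewrite lt_neqAle eq_sym m0 sumr_ge0.
set m := \sum_(psi <- r) mu psi in m0 m_gt0.
exfalso.
have var w : slice w ->
    \sum_(psi <- r) (gap (phi + psi) w - gap (phi + psi) v) * mu psi <= 0.
  move=> Sw; pose D psi := gap (phi + psi) w - gap (phi + psi) v.
  rewrite -/(\sum_(psi <- r) D psi * mu psi).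
  set P := \sum_(psi <- r) _; pose N := \sum_(psi <- r) D psi ^+ 2.
  have N0 : 0 <= N by apply: sumr_ge0 => psi _; exact: sqr_ge0.
  (* Moving v by the fraction t towards w changes f by at most - 2 t P + t^2 N, which cannot be
     negative at a minimiser. *)
  have PN t : 0 < t -> t <= 1 -> 2 * P <= t * N.
    move=> t0 t1; have := vmin (segm v w t) _.
    have Sv' : slice (segm v w t) by apply: slice_segm => //; rewrite ltW.
    move=> /(_ Sv'); rewrite /f.
    have : \sum_(psi <- r) pospart (delta - gap (phi + psi) (segm v w t)) ^+ 2 <=
        f v - 2 * t * P + t ^+ 2 * N.
      rewrite /f /P /N !mulr_sumr -sumrB -big_split/=.
      apply: ler_sum => psi _; rewrite gap_segm -/(D psi).
      rewrite opprD addrA (le_trans (pospart_sub _ _))// -/(mu psi) le_eqVlt.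
      by apply/orP; left; apply/eqP; ring.
    rewrite /f => h1 h2; have := le_trans h2 h1.
    rewrite -addrA lerDl addrC -mulrA expr2 -mulrA subr_ge0 => h3.
    rewrite -(ler_pM2l t0); move: h3; rewrite mulrCA//.
  rewrite leNgt; apply/negP => P0.
  have N1 : 0 < N + 1 by rewrite ltr_wpDl.
  have := PN (Num.min 1 (P / (N + 1))) _ _.
  rewrite lt_min ltr01 divr_gt0// ge_min lexx => /(_ isT isT).
  have : Num.min 1 (P / (N + 1)) * N <= P.
    apply: (@le_trans _ _ (P / (N + 1) * N)).
      by rewrite ler_wpM2r// ge_min lexx orbT.
    rewrite mulrAC ler_pdivrMr// mulrDr mulr1 lerDl ltW//.
  lra.
(* This convex combination stays in the ball, so some w has gap above delta for it. But the weighted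
   mean of the gaps is at most delta at v, and by [var] it is no larger at w. *)
pose psib : predual A := \sum_(psi <- r) (m^-1 * mu psi)%:C *: psi.
have gapb w : gap (phi + psib) w = m^-1 * \sum_(psi <- r) gap (phi + psi) w * mu psi.
  have pE (s : seq (predual A)) :
      complex.Re (pairing (alpha w) (\sum_(psi <- s) (m^-1 * mu psi)%:C *: psi)) =
      \sum_(psi <- s) m^-1 * mu psi * complex.Re (pairing (alpha w) psi).
    elim: s => [|psi s ih]; first by rewrite !big_nil pairing0r.
    by rewrite !big_cons pairingDr raddfD/= ih pairingZr Re_realM.
  rewrite gapDr /psib pE; under [in RHS]eq_bigr do rewrite gapDr mulrBl.
  rewrite sumrB mulrBr -mulr_sumr mulrCA -/m mulVf// mulr1; congr (_ - _).
  by rewrite mulr_sumr; apply: eq_bigr => psi _; ring.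
have [|w Sw] := h psib.
  have : nm psib <= \sum_(psi <- r) (m^-1 * mu psi) * c.
    rewrite /psib !big_seq; elim/big_ind2: _ => [|x1 y1 x2 y2 h1 h2|psi psir].
    - by rewrite nm0.
    - by rewrite (le_trans (nmD _ _))// lerD.
    - have k0 : 0 <= m^-1 * mu psi by rewrite mulr_ge0// invr_ge0 ltW.
      by rewrite nmZr ger0_norm// ler_wpM2l// rc.
  by rewrite -mulr_suml -mulr_sumr -/m mulVf// mul1r.
rewrite gapb mulrC ltr_pdivlMr// => h1.
have := var w Sw; under eq_bigr do rewrite mulrBl.
rewrite sumrB leNgt => /negP; apply; rewrite subr_gt0 (le_lt_trans _ h1)//.
rewrite /m mulr_sumr; apply: ler_sum => psi _.
have := pospart_mul (delta - gap (phi + psi) v); rewrite -/(mu psi).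
by have := sqr_ge0 (mu psi); lra.
Qed.

(** By [finite_minimax] the sets of v that serve finitely many psi form a proper filter base; a
    limit along a finer ultrafilter serves all psi. *)
Lemma compact_minimax phi c delta : 0 <= c ->
  (forall psi, nm psi <= c -> exists2 v, slice v & delta < gap (phi + psi) v) ->
  exists2 v, slice v &
    forall psi, nm psi <= c -> delta <= gap (phi + psi) v.
Proof.
move=> c0 h.
pose D := [set r : seq (predual A) | all (fun psi => nm psi <= c) r].
pose B (r : seq (predual A)) : set V := [set v | slice v /\
  forall psi, psi \in r -> delta <= gap (phi + psi) v].
have FF : ProperFilter (filter_from D B).
  apply: filter_from_proper; last first.
    by move=> r rc; have [v Sv vr] := finite_minimax c0 rc h; exists v.
  apply: filter_from_filter; first by exists [::].
  move=> r s rc sc; exists (r ++ s); first by rewrite /D/= all_cat; apply/andP.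
  move=> v [Sv vr]; split; split=> // psi psir;
    by apply: vr; rewrite mem_cat psir ?orbT.
have [U [UU FU]] := ultraFilterLemma FF.
have US : U slice by apply: FU; exists [::] => // v [].
have [v Sv vU] := cpt UU US; exists v => // psi psic.
apply: cvgr_to_ge (vU (phi + psi)) _.
apply: FU; exists [:: psi]; first by rewrite /D/= psic.
by move=> u [_]; apply; rewrite inE.
Qed.

(** Otherwise minimax gives one v in the slice with gap at least c / 2 for all corrections of norm
    at most c. The supremum over these yields gap phi v >= c |alpha v| + c / 2, against the
    hypothesis. *)
Lemma gap_halve phi c : 0 < c ->
  (forall v, Q v -> gap phi v <= c * nm (alpha v)) ->
  exists2 psi, nm psi <= c &
    forall v, Q v -> gap (phi + psi) v <= c / 2 * nm (alpha v).
Proof.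
move=> c0 hc; apply: contrapT => nh.
have [|psi psic|v Sv vc] := @compact_minimax phi c (c / 2).
- exact: ltW.
- apply: contrapT => nv; apply: nh; exists psi => // v Qv.
  have := nm_ge0 (alpha v); rewrite le_eqVlt => /orP[/eqP v0|v0].
    have /nm0_eq0 av0 := esym v0.
    by rewrite gapDr av0 pairing0l subr0 (le_trans (hc v Qv))// av0 nm0 !mulr0.
  rewrite leNgt; apply/negP => vc; apply: nv.
  exists (((nm (alpha v))^-1)%:C *: v); last first.
    by rewrite gapZ [ltRHS]mulrC ltr_pdivlMr.
  split; first by apply: QZ => //; rewrite invr_ge0 ltW.
  by rewrite alphaZ nmZr gtr0_norm ?invr_gt0// mulVf// gt_eqF.
- have [Qv v1] := Sv.
  have : nm (alpha v) <= (gap phi v - c / 2) / c.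
    apply: nm_pairing_Re_le => psi psi1; rewrite ler_pdivlMr// mulrC.
    rewrite -Re_realM -pairingZr.
    have := vc (c%:C *: psi); rewrite nmZr gtr0_norm// gapDr.
    rewrite -[X in _ <= X -> _]mulr1 ler_pM2l// => /(_ psi1); lra.
  by rewrite ler_pdivlMr//; have := hc v Qv; lra.
Qed.

Lemma normal_majorant (M : R) : 0 < M ->
  (forall v, Q v -> rho v <= M * nm (alpha v)) ->
  exists2 phi, nm phi <= 2 * M &
    forall v, Q v -> rho v <= complex.Re (pairing (alpha v) phi).
Proof.
move=> M0 hM; pose c n := M / 2 ^+ n.
have c0 n : 0 < c n by rewrite divr_gt0// exprn_gt0.
pose ok n phi := forall v, Q v -> gap phi v <= c n * nm (alpha v).
(* The correction has the default 0 where the invariant [ok] fails, so that the recursion [u] is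
   total and the invariant can be proved afterwards. *)
have /choice[f fP] (x : nat * predual A) : exists psi : predual A,
    ok x.1 x.2 -> nm psi <= c x.1 /\ ok x.1.+1 (x.2 + psi).
  have [okx|nok] := pselect (ok x.1 x.2); last by exists 0 => /nok.
  have [psi p1 p2] := gap_halve (c0 x.1) okx; exists psi => _; split=> // v Qv.
  apply: le_trans (p2 v Qv) _; rewrite /c exprSr invfM mulrA//.
pose u := fix u n : predual A := if n is m.+1 then u m + f (m, u m) else 0.
have uok n : ok n (u n).
  elim: n => [|n ih]; last by have [] := fP (n, u n) ih.
  move=> v Qv; rewrite /gap pairing0r (_ : complex.Re 0 = 0)// subr0 /c expr0 divr1.
  exact: hM.
have uc n : nm (u n.+1 - u n) <= geometric M 2^-1 n.
  by rewrite /= addrC addKr exprVn; have [] := fP (n, u n) (uok n).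
have u2 n : nm (u n) <= 2 * M - 2 * c n.
  elim: n => [|n ih]; first by rewrite nm0 /c expr0 divr1 subrr.
  have [h _] := fP (n, u n) (uok n).
  rewrite /= (le_trans (nmD _ _))// (le_trans (lerD ih h))//=.
  have -> : c n.+1 = c n / 2 by rewrite /c exprSr invfM mulrA.
  by lra.
have [|phi /nm_cvgP uphi] := nm_summable uc.
  by apply: is_cvg_geometric_series; rewrite ger0_norm ?invr_ge0//; lra.
have ct e : 0 < e -> exists N, forall n, (N <= n)%N -> c n < e.
  move=> e0; have h : `|2^-1 : R| < 1 by rewrite ger0_norm ?invr_ge0//; lra.
  have [N _ hN] := (cvgrPdist_lt _ _).1 (cvg_geometric M h) e e0.
  exists N => n /hN/=; rewrite sub0r normrN exprVn ger0_norm//.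
  by rewrite ltW// c0.
exists phi.
  apply/ler_addgt0Pl => e e0; have [N uN] := uphi e e0.
  rewrite (le_trans (nm_le_dist phi (u N)))// addrC lerD//; first exact/ltW/uN.
  by rewrite (le_trans (u2 N))// gerBl mulr_ge0// ltW.
move=> v Qv; rewrite -subr_le0 -/(gap phi v).
have av0 := nm_ge0 (alpha v).
have a1 : 0 < nm (alpha v) + 1 by rewrite ltr_wpDl.
apply/ler_addgt0Pl => e e0; rewrite addr0.
pose d := e / 2 / (nm (alpha v) + 1).
have d0 : 0 < d by rewrite !divr_gt0.
have [N1 h1] := ct d d0; have [N2 h2] := uphi d d0.
pose n := maxn N1 N2.
have -> : phi = u n + (phi - u n) by rewrite addrC subrK.
rewrite gapDr.
have g1 := uok n v Qv; have g2 := Re_pairing_le (phi - u n) (lexx (nm (alpha v))).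
have := h1 n (leq_maxl _ _); have := h2 n (leq_maxr _ _) => h3 h4.
have dE : e / 2 = d * (nm (alpha v) + 1) by rewrite /d divfK// gt_eqF.
have g3 : c n * nm (alpha v) <= e / 2.
  by rewrite dE ler_pM ?(ltW (c0 n))// ?lerDl// ltW.
have g4 : nm (alpha v) * nm (phi - u n) <= e / 2.
  by rewrite dE mulrC ler_pM ?nm_ge0// ?lerDl// ltW.
have := le_trans g2 g4; rewrite ler_norml => /andP[g5 _]; lra.
Qed.

End KreinSmulian.

(** * Domination of a normal functional by a positive one *)

Section NormalPositive.
Variables (R : realType) (A : wstarType R).
Implicit Types (a b h p : A) (phi psi tau omega : predual A) (M s : R).

Definition npos omega := forall p, pos p -> 0 <= pairing p omega.

Lemma pos0 : pos (0 : A).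
Proof. by rewrite -sc0; exact: pos_sc. Qed.

Lemma Re_iM (z : R[i]) : complex.Re ('i * z) = - complex.Im z.
Proof. by case: z => x y /=; ring. Qed.

(** Apply [normal_majorant] to Re tau(p1) - Re tau(p2) over p1 + p2 + i h. Triples with one nonzero
    entry p1 or p2 give the two signs of the first claim; h and - h give Re omega(i h) = 0. The norm
    of p1 + p2 + i h controls each entry, hence compactness and the constant 2. *)
Lemma hermitian_majorant tau : nm tau <= 1 -> exists2 omega, nm omega <= 4 &
  (forall p, pos p -> `|complex.Re (pairing p tau)| <= complex.Re (pairing p omega))
  /\ (forall h, star h = h -> complex.Im (pairing h omega) = 0).
Proof.
move=> t1.
pose Q (v : A * A * A) := [/\ pos v.1.1, pos v.1.2 & star v.2 = v.2].
pose alpha (v : A * A * A) : A := v.1.1 + v.1.2 + 'i *: v.2.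
pose rho (v : A * A * A) : R :=
  complex.Re (pairing v.1.1 tau) - complex.Re (pairing v.1.2 tau).
have Qle v : Q v -> [/\ nm v.1.1 <= nm (alpha v), nm v.1.2 <= nm (alpha v) &
    nm v.2 <= nm (alpha v)].
  move=> [p1 p2 h].
  have s12 : star (v.1.1 + v.1.2) = v.1.1 + v.1.2.
    by rewrite starD (pos_selfadj p1) (pos_selfadj p2).
  have le12 : nm (v.1.1 + v.1.2) <= nm (alpha v) by exact: nm_re_le.
  split; last exact: nm_im_le.
    by apply: le_trans le12; apply: pos_nm_mono => //; rewrite addrC addKr.
  by apply: le_trans le12; apply: pos_nm_mono => //; rewrite addrK.
have [|||||||||omega o1 o2] := @normal_majorant R A (A * A * A)%type Q alpha rho
    _ _ _ _ _ _ _ 2 _ _.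
- by move=> u v [? ? hu] [? ? hv]; split; try exact: posD; rewrite starD hu hv.
- by move=> t v t0 [? ? hv]; split; try exact: posZ; rewrite starZr hv.
- by move=> u v; rewrite /alpha/= scalerDr; zmod.
- by move=> t v; rewrite /alpha/= !scalerDr !scalerA mulrC.
- by move=> u v; rewrite /rho/= !pairingDl !raddfD/=; ring.
- by move=> t v; rewrite /rho/= !pairingZl !Re_realM; ring.
- move=> U UU US; have UP : ProperFilter U by exact: ultra_proper.
  have U1 : U [set v | Q v /\ nm (alpha v) <= 1] by exact: US.
  have Un : U [set v | nm v.1.1 <= 1 /\ nm v.1.2 <= 1 /\ nm v.2 <= 1].
    apply: filterS U1 => v [/Qle[h1 h2 h3] v1].
    by split; [|split]; exact: le_trans v1.
  have [a ga] : exists a, wcvg U (fun v : A * A * A => v.1.1) a.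
    by apply: (@wcvg_exists _ _ _ _ _ _ 1); apply: filterS Un => v [].
  have [b gb] : exists a, wcvg U (fun v : A * A * A => v.1.2) a.
    by apply: (@wcvg_exists _ _ _ _ _ _ 1); apply: filterS Un => v [_ []].
  have [h gh] : exists a, wcvg U (fun v : A * A * A => v.2) a.
    by apply: (@wcvg_exists _ _ _ _ _ _ 1); apply: filterS Un => v [_ []].
  have UQ : U [set v | Q v /\ (nm v.1.1 <= 1 /\ nm v.1.2 <= 1 /\ nm v.2 <= 1)].
    by apply: filterS (filterI U1 Un) => v [[]].
  have gal : wcvg U alpha (a + b + 'i *: h).
    by apply: wcvgD; [exact: wcvgD|exact: wcvgZ].
  exists (a, b, h).
    split; [split|] => /=.
    + by apply: (@wcvg_pos _ _ _ _ UP _ _ 1 ga); apply: filterS UQ => v [[? ? ?] [? [? ?]]].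
    + by apply: (@wcvg_pos _ _ _ _ UP _ _ 1 gb); apply: filterS UQ => v [[? ? ?] [? [? ?]]].
    + by apply: (@wcvg_selfadj _ _ _ _ UP _ _ 1 gh); apply: filterS UQ => v [[? ? ?] [? [? ?]]].
    + by apply: (@wcvg_nm_le _ _ _ _ UP _ _ 1 gal); apply: filterS U1 => v [].
  move=> phi; apply: cvgB; last exact: gal.
  by apply: cvgB; [exact: ga|exact: gb].
- by [].
- move=> v /Qle[h1 h2 _].
  have := Re_pairing_le tau h1; have := Re_pairing_le tau h2.
  rewrite !ler_norml => /andP[g1 _] /andP[_ g2].
  have : nm (alpha v) * nm tau <= nm (alpha v) by rewrite ler_piMr ?nm_ge0.
  by rewrite /rho; lra.
- exists omega; first by rewrite (le_trans o1)//; lra.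
  split=> [p pp|h hh].
    have := o2 (p, 0, 0); have := o2 (0, p, 0).
    rewrite /Q /rho /alpha /= !scaler0 !addr0 !add0r !pairing0l /= subr0 sub0r.
    move=> g1 g2; rewrite ler_norml -lerNl; apply/andP; split.
      by apply: g1; split => //; [exact: pos0|exact: star0].
    by apply: g2; split => //; [exact: pos0|exact: star0].
  have := o2 (0, 0, h); have := o2 (0, 0, - h).
  rewrite /Q /rho /alpha /= !addr0 !add0r !pairing0l /= subr0 !pairingZl !Re_iM.
  rewrite pairingNl raddfN/= => g1 g2.
  have := g1 _; have := g2 _.
  move=> /(_ (And3 pos0 pos0 hh)) h2; rewrite starN hh.
  by move=> /(_ (And3 pos0 pos0 erefl)) h1; lra.
Qed.

(** |z| <= |Re z| + |Im z|, so the majorants for tau and - i tau are added. Their vanishing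
    imaginary parts make the sum positive. *)
Lemma normal_dominate tau : nm tau <= 1 -> exists2 omega, nm omega <= 8 &
  npos omega /\
  forall p, pos p -> nm (pairing p tau) <= complex.Re (pairing p omega).
Proof.
move=> t1; have [o1 n1 [m1 i1]] := hermitian_majorant t1.
have [|o2 n2 [m2 i2]] := @hermitian_majorant (- 'i *: tau).
  by rewrite nmZ nmN nm_i mul1r.
have key p : pos p -> nm (pairing p tau) <= complex.Re (pairing p (o1 + o2)).
  move=> pp; rewrite (le_trans (nm_le_ReIm _))// pairingDr raddfD/= lerD//.
    exact: m1.
  by rewrite Im_Re -pairingZr; exact: m2.
exists (o1 + o2); first by rewrite (le_trans (nmD _ _))//; lra.
split=> // p pp; have := le_trans (nm_ge0 _) (key p pp).
rewrite lecE/= => ->; rewrite andbT pairingDr raddfD/=.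
by rewrite i1 ?i2 ?addr0//; exact: pos_selfadj.
Qed.

Lemma npos_Re_ge0 omega p : npos omega -> pos p ->
  0 <= complex.Re (pairing p omega).
Proof. by move=> oo pp; have := oo p pp; rewrite lecE => /andP[]. Qed.

Lemma nposD phi psi : npos phi -> npos psi -> npos (phi + psi).
Proof. by move=> h1 h2 p pp; rewrite pairingDr addr_ge0 ?h1 ?h2. Qed.

Lemma nposZ s phi : 0 <= s -> npos phi -> npos (s%:C *: phi).
Proof. by move=> s0 h1 p pp; rewrite pairingZr mulr_ge0 ?h1 ?lecR. Qed.

End NormalPositive.

(** * Hilbert modules and the weak* topology *)

Section Inner.
Variables (R : realType) (A : cstarType R) (E : hilbertModType A).
Implicit Types (x y z : E).

Lemma innerDr x y z : inner x (y + z) = inner x y + inner x z.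
Proof. by have := innerDZr x 1 y z; rewrite !scale1r. Qed.

Lemma inner0r x : inner x 0 = 0.
Proof. by apply: (addrI (inner x 0)); rewrite -innerDr !addr0. Qed.

Lemma innerZr (c : R[i]) x y : inner x (c *: y) = c *: inner x y.
Proof. by have := innerDZr x c y 0; rewrite inner0r !addr0. Qed.

Lemma innerDl x y z : inner (x + y) z = inner x z + inner y z.
Proof. by rewrite -star_inner innerDr starD !star_inner. Qed.

Lemma innerZl (c : R[i]) x y : inner (c *: x) y = conjc c *: inner x y.
Proof. by rewrite -star_inner innerZr starZ star_inner. Qed.

Lemma innerNr x y : inner x (- y) = - inner x y.
Proof. by rewrite -scaleN1r innerZr scaleN1r. Qed.

Lemma innerNl x y : inner (- x) y = - inner x y.
Proof. by rewrite -star_inner innerNr starN star_inner. Qed.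

Lemma pos_inner x : pos (inner x x).
Proof. by have [b ->] := inner_positive x; exact: pos_star_mul. Qed.

Lemma nm_inner x : nm (inner x x) = nm x ^+ 2.
Proof. by apply/complexI; rewrite rmorphXn/= -!nmE norm_inner. Qed.

Lemma polarization x y : (4 : R)%:C *: inner x y =
  (inner (x + y) (x + y) - inner (x - y) (x - y))
  - 'i *: (inner (x + 'i *: y) (x + 'i *: y)
           - inner (x - 'i *: y) (x - 'i *: y)).
Proof.
rewrite !(innerDl, innerDr, innerNl, innerNr, innerZl, innerZr) conjc_i.
rewrite !(scalerDr, scalerN, scaleNr, scalerA, mulrN, mulNr) -!(expr2 'i) sqrCi.
rewrite !(mulrN, mulNr, mulr1, mul1r, scaleNr, scale1r, opprK, scaleN1r).
have -> : (4 : R)%:C = 1 + 1 + (1 + 1) :> R[i].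
  by rewrite -(rmorph1 (real_complex R)) -!rmorphD/=; congr (_ %:C); lra.
by rewrite !scalerDl !scale1r; zmod.
Qed.

End Inner.

Section NormalForm.
Variables (R : realType) (A : wstarType R) (E : hilbertModType A).
Implicit Types (x y z : E) (tau omega : predual A) (s : R).

Definition sqn omega x : R := complex.Re (pairing (inner x x) omega).

Lemma sqn_ge0 omega x : npos omega -> 0 <= sqn omega x.
Proof. by move=> o; apply: npos_Re_ge0 => //; exact: pos_inner. Qed.

Lemma sqnN omega x : sqn omega (- x) = sqn omega x.
Proof. by rewrite /sqn innerNl innerNr opprK. Qed.

Lemma sqnZ omega s x : sqn omega (s%:C *: x) = s ^+ 2 * sqn omega x.
Proof.
by rewrite /sqn innerZl innerZr conjc_real !pairingZl !Re_realM; ring.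
Qed.

Lemma sqnD_parallelogram omega x y :
  sqn omega (x + y) + sqn omega (x - y) = 2 * sqn omega x + 2 * sqn omega y.
Proof.
rewrite /sqn !(innerDl, innerDr, innerNl, innerNr).
by rewrite !(pairingDl, pairingNl) !(raddfD, raddfN)/=; ring.
Qed.

Lemma sqnZi omega x : sqn omega ('i *: x) = sqn omega x.
Proof.
by rewrite /sqn innerZl innerZr conjc_i scalerA mulNr -(expr2 'i) sqrCi opprK scale1r.
Qed.

(** Polarization reduces to squares, where omega dominates tau, and the parallelogram law adds these
    up. Passing to s^-1 x and s y keeps <x, y> and allows the y-term to be made small. *)
Lemma normal_inner_le tau omega x y s : 0 < s ->
  (forall p, pos p -> nm (pairing p tau) <= complex.Re (pairing p omega)) ->
  nm (pairing (inner x y) tau) <= s ^- 2 * sqn omega x + s ^+ 2 * sqn omega y.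
Proof.
move=> s0 dom.
have le1 u v : nm (pairing (inner u v) tau) <= sqn omega u + sqn omega v.
  have d z : nm (pairing (inner z z) tau) <= sqn omega z.
    by apply: dom; exact: pos_inner.
  have : nm (pairing ((4 : R)%:C *: inner u v) tau) <=
      (sqn omega (u + v) + sqn omega (u - v)) +
      (sqn omega (u + 'i *: v) + sqn omega (u - 'i *: v)).
    rewrite polarization pairingBl pairingZl !pairingBl.
    rewrite (le_trans (nmDB _ _))// nmM nm_i mul1r.
    by rewrite lerD// (le_trans (nmDB _ _))// lerD.
  rewrite !sqnD_parallelogram sqnZi pairingZl nmM nm_real ger0_norm; lra.
have := le1 ((s^-1)%:C *: x) (s%:C *: y).
rewrite !sqnZ innerZl innerZr conjc_real scalerA -rmorphM/= mulVf ?gt_eqF//.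
by rewrite scale1r exprVn.
Qed.

End NormalForm.

(** * Weak* neighbourhoods contain seminorm balls *)

Section WeakStarFun.
Variables (R : realType) (A : wstarType R).
Implicit Types (a p : A) (omega : predual A) (s : R).

Lemma pairing_cvg (S : nat -> predual A) omega a : S @ \oo --> omega ->
  (fun n => pairing a (S n) : R[i]^o) @ \oo --> (pairing a omega : R[i]^o).
Proof.
move=> /nm_cvgP Sw; apply/nm_cvgP => e e0.
have a0 : 0 < nm a + 1 by rewrite ltr_wpDl ?nm_ge0.
have [|N SN] := Sw (e / (nm a + 1)); first by rewrite divr_gt0.
exists N => n /SN; rewrite ltr_pdivlMr// => h.
rewrite -pairingBr (le_lt_trans (nm_pairing _ _))// (le_lt_trans _ h)//.
by rewrite mulrC ler_wpM2l ?nm_ge0// lerDl.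
Qed.

Lemma Re_cvg (u : nat -> R[i]^o) (l : R[i]) : u @ \oo --> (l : R[i]^o) ->
  (fun n => complex.Re (u n)) @ \oo --> complex.Re l.
Proof.
move=> /nm_cvgP ul; apply/cvgrPdist_lt => e /ul[N uN].
exists N => // n /= /uN; apply: le_lt_trans.
by rewrite -raddfB normRe_nm.
Qed.

Lemma nm_cvg_le (V : normedModType R[i]) (u : nat -> V) (l : V) (B : R) :
  u @ \oo --> l -> (forall n, nm (u n) <= B) -> nm l <= B.
Proof.
move=> /nm_cvgP ul uB; apply/ler_addgt0Pl => e /ul[N uN].
rewrite (le_trans (nm_le_dist l (u N)))// addrC lerD//; apply/ltW/uN => //.
Qed.

(** The series converges absolutely in the predual, and its partial sums increase on positive
    elements. *)
Lemma npos_series (c : nat -> R) (o : nat -> predual A) (M : R) :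
  (forall j, 0 <= c j) -> cvgn (series c) ->
  (forall j, nm (o j) <= M) -> (forall j, npos (o j)) ->
  exists2 omega, npos omega & forall p n, pos p ->
    \sum_(0 <= j < n) c j * complex.Re (pairing p (o j)) <=
    complex.Re (pairing p omega).
Proof.
move=> c0 cc oM oo; pose S := series (fun j => (c j)%:C *: o j).
have SS n : S n.+1 = S n + (c n)%:C *: o n by rewrite /S /series/= big_nat_recr.
have Sp n : npos (S n).
  elim: n => [|n ih]; last by rewrite SS; apply: nposD => //; exact: nposZ.
  by move=> p _; rewrite /S /series/= big_geq// pairing0r.
have [|omega Sw] := @nm_summable _ _ S (M *: c) _ (@is_cvg_seriesZ _ _ M cc).
  by move=> n; rewrite SS addrC addKr nmZr ger0_norm// mulrC ler_wpM2r.
exists omega => [p pp|p n pp].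
  apply: (@complex_cvg_ge0 R (fun n => pairing p (S n)) _ (@pairing_cvg S _ p Sw)).
  by near=> n; exact: Sp.
have SE k : complex.Re (pairing p (S k)) =
    \sum_(0 <= j < k) c j * complex.Re (pairing p (o j)).
  elim: k => [|k ih].
    by rewrite /S /series/= !big_geq// pairing0r.
  by rewrite SS big_nat_recr//= -ih pairingDr raddfD/= pairingZr Re_realM.
have uc := Re_cvg (@pairing_cvg S _ p Sw).
rewrite -(cvg_lim (@norm_hausdorff _ _) uc) -SE.
apply: (@nondecreasing_cvgn_le _ (fun n => complex.Re (pairing p (S n)))).
  apply/nondecreasing_seqP => k; rewrite SS pairingDr raddfD/= lerDl.
  by rewrite pairingZr Re_realM mulr_ge0//; exact: npos_Re_ge0.
by apply/cvg_ex; exists (complex.Re (pairing p omega)).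
Unshelve. all: by end_near. Qed.

Variable E : hilbertModType A.
Implicit Types (x y z : E).

(** The majorants of the [normal_fun i j], weighted by [coef], add up to one omega. As they have
    norm at most 8 and |y_j| = 1, the terms in y_j contribute at most 8 times the sum of the
    weights. *)
Lemma weak_star_fun_dominated (i : weak_star_index E) :
  exists omega (K : R), [/\ npos omega, 0 <= K & forall x z s, 0 < s ->
    nm (weak_star_fun i x - weak_star_fun i z) <=
    s ^- 2 * sqn omega (x - z) + s ^+ 2 * K].
Proof.
have n1 j : nm (normal_fun i j) = 1 by rewrite /nm norm_normal_fun.
have v1 j : nm (vect i j) = 1 by rewrite /nm norm_vect.
have c0 j : 0 <= coef i j by rewrite ltW// coef_gt0.
have /choice[o oP] j : exists omega, nm omega <= 8 /\ (npos omega /\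
    forall p, pos p -> nm (pairing p (normal_fun i j)) <= complex.Re (pairing p omega)).
  by have [|omega h1 h2] := @normal_dominate R A (normal_fun i j);
    [rewrite n1|exists omega].
have [omega op ole] : exists2 omega, npos omega & forall p n, pos p ->
    \sum_(0 <= j < n) coef i j * complex.Re (pairing p (o j)) <=
    complex.Re (pairing p omega).
  apply: (@npos_series _ _ 8) => // [|j|j]; first exact: coef_summable.
    by have [] := oP j.
  by have [_ []] := oP j.
pose K := limn (series (coef i)).
have KP n : series (coef i) n <= K.
  apply: nondecreasing_cvgn_le; last exact: coef_summable.
  by apply/nondecreasing_seqP => k; rewrite /series/= big_nat_recr//= lerDl.
have K0 : 0 <= K by apply: le_trans (KP 0%N); rewrite /series/= big_geq.
pose t x j : R[i]^o := (coef i j)%:C * pairing (inner x (vect i j)) (normal_fun i j).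
have tle x j s : 0 < s ->
    nm (t x j) <= coef i j * (s ^- 2 * sqn (o j) x + s ^+ 2 * 8).
  move=> s0; rewrite /t nmM nm_real ger0_norm// ler_wpM2l//.
  have [o8 [oj od]] := oP j.
  rewrite (le_trans (normal_inner_le x (vect i j) s0 od))// lerD2l.
  rewrite ler_wpM2l ?sqr_ge0// (le_trans (Re_nm _))//.
  by rewrite (le_trans (nm_pairing _ _))// nm_inner v1 expr1n mul1r.
have bound x s n : 0 < s ->
    nm (series (t x) n) <= s ^- 2 * sqn omega x + s ^+ 2 * (8 * K).
  move=> s0; apply: (@le_trans _ _ (\sum_(0 <= j < n) nm (t x j))).
    rewrite /series/=; elim/big_ind2: _ => [|x1 y1 x2 y2 h1 h2|//].
      by rewrite nm0.
    by rewrite (le_trans (nmD _ _))// lerD.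
  apply: (@le_trans _ _ (\sum_(0 <= j < n)
      (s ^- 2 * (coef i j * sqn (o j) x) + s ^+ 2 * (8 * coef i j)))).
    by apply: ler_sum => j _; apply: le_trans (tle x j s s0) _;
      rewrite le_eqVlt; apply/orP; left; apply/eqP; ring.
  rewrite big_split/= -!mulr_sumr lerD//.
    by rewrite ler_wpM2l ?invr_ge0 ?sqr_ge0//; apply: ole; exact: pos_inner.
  by rewrite ler_wpM2l ?sqr_ge0// ler_wpM2l//; exact: KP.
(* [limn] carries information only for convergent series; the case s = 1 of the term bound gives
   convergence. *)
have tc x : cvgn (series (t x)).
  apply: complex_cauchy_cvg => e /posc_real[r r0 ->].
  have [||N uN] := @nm_cauchy_le R R[i]^o (series (t x))
      ((nm x ^+ 2 * 8 + 8) *: coef i) _ _ r r0.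
  - move=> n; rewrite /series/= big_nat_recr//= [_ + t x n]addrC addrK.
    apply: le_trans (tle x n 1 ltr01) _.
    rewrite expr1n invr1 !mul1r [leRHS]mulrC ler_wpM2l// lerD2r.
    rewrite (le_trans (Re_nm _))// (le_trans (nm_pairing _ _))// nm_inner.
    by have [o8 _] := oP n; rewrite ler_wpM2l// sqr_ge0.
  - by apply: is_cvg_seriesZ; exact: coef_summable.
  - by exists N => m n Nm Nn; have := uN m n Nm Nn; rewrite -ltcR -nmE.
exists omega, (8 * K); split => //; first by rewrite mulr_ge0.
move=> x z s s0.
apply: (@nm_cvg_le R[i]^o (fun n => series (t x) n - series (t z) n)).
  by apply: cvgB; [exact: tc|exact: tc].
move=> n; have -> : series (t x) n - series (t z) n = series (t (x - z)) n.
  rewrite /series/= -sumrB; apply: eq_bigr => j _.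
  by rewrite /t innerDl innerNl pairingBl mulrBr.
exact: bound.
Qed.

(** Seminorm balls around x0 form a filter base, by adding forms and taking the smaller radius. The
    filter converges to x0 for every defining functional, hence in the supremum topology. *)
Lemma weak_star_nbhs (x0 : weak_star E) (N : set (weak_star E)) :
  nbhs x0 N -> exists omega (e : R), [/\ npos omega, 0 < e &
    forall x : E, sqn omega (x - x0) < e -> N x].
Proof.
pose D : set (predual A * R) := [set q | npos q.1 /\ 0 < q.2].
pose B (q : predual A * R) : set E := [set x : E | sqn q.1 (x - (x0 : E)) < q.2].
have FF : Filter (filter_from D B).
  apply: filter_from_filter.
    by exists (0, 1); split => //= p _; rewrite pairing0r.
  move=> [o1 e1] [o2 e2] [/= p1 e10] [/= p2 e20].
  exists (o1 + o2, Num.min e1 e2).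
    by split; [exact: nposD|rewrite /= lt_min e10].
  move=> x; rewrite /B/= /sqn pairingDr raddfD/= lt_min => /andP[h1 h2].
  have := sqn_ge0 (x - x0) p1; have := sqn_ge0 (x - x0) p2; rewrite /sqn => h3 h4.
  by split => /=; lra.
have : filter_from D B --> x0.
  apply/cvg_sup => i M; rewrite nbhsE => -[_ [[O oO <-] Ox0] OM].
  have [o [K [op K0 oK]]] := weak_star_fun_dominated i.
  have /nbhs_ballP[_ /posc_real[e e0 ->] eO] := open_nbhs_nbhs (conj oO Ox0).
  (* s is fixed first, to make the term in K small; the radius s^2 e / 4 then compensates for the
     factor s^-2. *)
  have [s s0 sK] : exists2 s : R, 0 < s & s ^+ 2 * K <= e / 4.
    exists (Num.sqrt (e / 4 / (K + 1))).
      by rewrite sqrtr_gt0 !divr_gt0// ltr_wpDl.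
    rewrite sqr_sqrtr; last by rewrite !divr_ge0 ?(ltW e0)// addr_ge0.
    rewrite mulrAC ler_pdivrMr ?ltr_wpDl// ler_wpM2l ?lerDl//.
    by rewrite divr_ge0 ?(ltW e0).
  exists (o, s ^+ 2 * (e / 4)).
    by split => //=; rewrite mulr_gt0 ?exprn_gt0 ?divr_gt0.
  move=> x /= xB; apply: OM; apply: eO.
  rewrite -ball_normE /= nmE ltcR nmB (le_lt_trans (oK x x0 s s0))//.
  have : s ^- 2 * sqn o (x - x0) < e / 4 by rewrite mulrC ltr_pdivrMr ?exprn_gt0// mulrC.
  by move: sK; lra.
move=> /[apply] -[[omega e] [/= op e0] BN].
by exists omega, e; split => // x xe; apply: BN.
Qed.

End WeakStarFun.

(** * Orthogonal complements and normal states *)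

Section Projection.
Variables (R : realType) (H : hilbertType R).
Implicit Types (x y h l : H) (S : set H).

Lemma dot_ge0 x : 0 <= dot x x.
Proof. by rewrite dot_norm exprn_ge0. Qed.

Definition dot_form : semi_inner H :=
  SemiInner (@dotDZr R H) (@dot_conj R H) dot_ge0.

Lemma dotE x y : dot x y = dot_form x y.
Proof. by []. Qed.

Lemma nm_dot x : nm x ^+ 2 = complex.Re (dot x x).
Proof. by rewrite dot_norm nmE -rmorphXn. Qed.

Lemma nm_parallelogram x y :
  nm (x + y) ^+ 2 + nm (x - y) ^+ 2 = 2 * nm x ^+ 2 + 2 * nm y ^+ 2.
Proof.
rewrite !nm_dot !dotE.
rewrite !(Defs.formDl, Defs.formDr, Defs.formNl, Defs.formNr) !(raddfD, raddfN)/=; ring.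
Qed.

Lemma nm_subZ x y (c : R[i]) : nm (x - c *: y) ^+ 2 =
  nm x ^+ 2 - 2 * complex.Re (c * dot x y) + nm c ^+ 2 * nm y ^+ 2.
Proof.
have nyy : dot y y = (nm y ^+ 2)%:C by rewrite dot_norm nmE rmorphXn.
have conjE : conjc c * dot y x = conjc (c * dot x y).
  by rewrite -(dot_conj x y) rmorphM.
rewrite !nm_dot 2!dotE Defs.formBl !Defs.formBr !Defs.formZl !Defs.formZr.
rewrite /= conjE (mulrA (conjc c)) nm_conjc nyy -rmorphM/=.
by case: (c * dot x y) => u v; case: (dot x x) => u' v' /=; ring.
Qed.

(** By the parallelogram law the differences y - l_n of a minimising sequence are Cauchy. Their
    limit h has norm at most the distance D > 0, while h - c x never gets shorter than D for x in S;
    hence h is nonzero and orthogonal to S. *)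
Lemma orthogonal_complement_neq0 S y (d : R) : 0 < d ->
  S 0 -> (forall x z, S x -> S z -> S (x + z)) ->
  (forall (c : R[i]) x, S x -> S (c *: x)) ->
  (forall x, S x -> d <= nm (y - x)) ->
  orthogonal_complement S <> [set 0].
Proof.
move=> d0 S0 SD SZ Sd; pose D := inf [set nm (y - x) | x in S].
have hI : has_inf [set nm (y - x) | x in S].
  by split; [exists (nm (y - 0)), 0|exists 0 => _ [x _ <-]; exact: nm_ge0].
have DP x : S x -> D <= nm (y - x) by move=> Sx; apply: ge_inf; [exact: hI.2|exists x].
have dD : d <= D by apply: lb_le_inf; [exact: hI.1|move=> _ [x Sx <-]; exact: Sd].
have D0 : 0 < D by exact: lt_le_trans dD.
have /choice[l lP] n : exists l, S l /\ nm (y - l) <= D + n.+1%:R^-1.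
  have n0 : 0 < n.+1%:R^-1 :> R by rewrite invr_gt0.
  have [_ [l Sl <-] lD] := inf_adherent n0 hI.
  by exists l; split => //; exact: ltW.
pose w n := y - l n.
have wB m n N : (N <= m)%N -> (N <= n)%N ->
    nm (w m - w n) ^+ 2 <= (8 * D + 4) * N.+1%:R^-1.
  move=> Nm Nn.
  have e1 : N.+1%:R^-1 <= 1 :> R by rewrite invf_le1 ?ler1n.
  have e0 : 0 <= N.+1%:R^-1 :> R by rewrite invr_ge0.
  have wle k : (N <= k)%N -> nm (w k) ^+ 2 <= (D + N.+1%:R^-1) ^+ 2.
    move=> Nk; rewrite ler_pXn2r ?nnegrE ?nm_ge0 ?addr_ge0 ?(ltW D0)//.
    by rewrite (le_trans (lP k).2)// lerD2l lef_pV2 ?posrE// ler_nat.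
  have wD : (2 * D) ^+ 2 <= nm (w m + w n) ^+ 2.
    rewrite ler_pXn2r ?nnegrE ?nm_ge0 ?mulr_ge0 ?(ltW D0)//.
    have -> : w m + w n = (2 : R)%:C *: (y - (2^-1 : R)%:C *: (l m + l n)).
      rewrite scalerBr scalerA -rmorphM/= divff// scale1r.
      have -> : (2 : R)%:C = 1 + 1 by rewrite -(rmorph1 (real_complex R)) -rmorphD/=; congr (_ %:C); lra.
      by rewrite scalerDl scale1r /w; zmod.
    rewrite nmZr ger0_norm// ler_pM2l//; apply: DP; apply: SZ.
    by apply: SD; [exact: (lP m).1|exact: (lP n).1].
  have := nm_parallelogram (w m) (w n); have := wle m Nm; have := wle n Nn.
  move: wD e1 e0; set e := N.+1%:R^-1 => wD e1 e0 h1 h2 h3.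
  have : e ^+ 2 <= e by rewrite expr2 ler_piMl.
  move: wD h1 h2; rewrite !expr2 => wD h1 h2; nra.
have [h wh] : exists h : H, w @ \oo --> h.
  apply: nm_complete => e e0.
  have [N NP] : exists N, (8 * D + 4) / e ^+ 2 < N%:R.
    exists (Num.bound ((8 * D + 4) / e ^+ 2)); rewrite archi_boundP//.
    by rewrite divr_ge0 ?sqr_ge0// addr_ge0// mulr_ge0// ltW.
  exists N => m n Nm Nn.
  rewrite -(@ltr_pXn2r _ 2)// ?nnegrE ?nm_ge0 ?(ltW e0)//.
  rewrite (le_lt_trans (wB m n N Nm Nn))// ltr_pdivrMr// [ltRHS]mulrC -ltr_pdivrMr ?exprn_gt0//.
  by rewrite (lt_trans NP)// ltr_nat.
have hD c x : S x -> D <= nm (h - c *: x).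
  move=> Sx; apply/ler_addgt0Pr => e e0.
  have [N wN] := (nm_cvgP w h).1 wh e e0.
  have : D <= nm (w N - c *: x).
    by rewrite /w -addrA -opprD; apply: DP; apply: SD; [exact: (lP N).1|exact: SZ].
  move=> /le_trans; apply; rewrite (le_trans (nm_le_dist _ (h - c *: x)))//.
  rewrite lerD2l nmB (_ : _ - _ = h - w N); last by zmod.
  by rewrite ltW// wN.
have Dh : nm h <= D.
  apply/ler_addgt0Pr => e e0; have e2 : 0 < e / 2 by rewrite divr_gt0.
  have [N1 wN] := (nm_cvgP w h).1 wh _ e2.
  pose N := maxn N1 (Num.bound (e / 2)^-1).
  have h1 := wN N (leq_maxl _ _).
  have h2 : N.+1%:R^-1 <= e / 2.
    rewrite -[e / 2]invrK lef_pV2 ?posrE ?invr_gt0//.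
    rewrite (le_trans (ltW (archi_boundP _)))// ?invr_ge0 ?(ltW e2)//.
    by rewrite ler_nat ltnW// ltnS leq_maxr.
  rewrite (le_trans (nm_le_dist h (w N)))//.
  apply: le_trans (lerD (lP N).2 (ltW h1)) _; rewrite -addrA lerD2l.
  by rewrite [leRHS]splitr lerD2r.
have h_neq0 : h <> 0.
  move=> h0; have := hD 0 0 S0; rewrite h0 scaler0 subr0 nm0 leNgt.
  by rewrite D0.
suff hS : orthogonal_complement S h by move=> SE; apply: h_neq0; rewrite SE in hS.
move=> x Sx; apply/nm0_eq0/eqP; rewrite -sqrf_eq0.
set z := dot h x; pose Z := nm z ^+ 2.
have Z0 : 0 <= Z by exact: sqr_ge0.
have X0 : 0 <= nm x ^+ 2 by exact: sqr_ge0.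
(* The added 1 covers x = 0 and keeps t |x|^2 <= 1, which is all the estimate uses. *)
pose t := (nm x ^+ 2 + 1)^-1.
have t0 : 0 < t by rewrite invr_gt0 ltr_wpDl.
have := hD (t%:C * conjc z) x Sx.
rewrite -(@ler_pXn2r _ 2)// ?nnegrE ?nm_ge0 ?(ltW D0)// nm_subZ -/z.
rewrite -mulrA nm_conjc -rmorphM/= nmM nm_real gtr0_norm//.
have -> : nm (conjc z) = nm z by rewrite /nm norm_conjc.
rewrite exprMn -/Z => h1.
have h2 : nm h ^+ 2 <= D ^+ 2 by rewrite ler_pXn2r ?nnegrE ?nm_ge0 ?(ltW D0).
have h3 : t * nm x ^+ 2 <= 1.
  by rewrite mulrC ler_pdivrMr ?mul1r ?lerDl// ltr_wpDl.
have h4 : 2 * (t * Z) <= t * Z.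
  have : t ^+ 2 * Z * nm x ^+ 2 = (t * Z) * (t * nm x ^+ 2) by ring.
  have : (t * Z) * (t * nm x ^+ 2) <= t * Z.
    by rewrite ler_piMr// mulr_ge0// ltW.
  lra.
have : t * Z <= 0 by lra.
by rewrite pmulr_rle0// => Z1; rewrite -/Z eq_le Z1.
Qed.

End Projection.

(** * Normal states and the distance in the completion *)

Section NormalState.
Variables (R : realType) (A : wstarType R).
Implicit Types (a p h : A) (phi : predual A).

Lemma pos_cone : pos (cone : A).
Proof. by have := @pos_sc R A 1 ler01; rewrite sc1. Qed.

Lemma pairing_sc t phi : pairing (sc A t) phi = t%:C * pairing cone phi.
Proof. exact: pairingZl. Qed.

Lemma npos_le phi h : npos phi -> star h = h ->
  complex.Re (pairing h phi) <= nm h * complex.Re (pairing cone phi).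
Proof.
move=> pp hh; have := npos_Re_ge0 pp (pos_scB hh).
by rewrite pairingBl raddfB/= pairing_sc Re_realM subr_ge0.
Qed.

Lemma npos_Im0 phi h : npos phi -> star h = h ->
  complex.Im (pairing h phi) = 0.
Proof.
move=> pp hh.
have I0 p : pos p -> complex.Im (pairing p phi) = 0.
  by move=> /pp; rewrite lecE => /andP[/eqP].
have -> : h = (sc A (nm h) + h) - sc A (nm h) by zmod.
rewrite pairingBl raddfB/= !I0 ?subrr//; first exact/pos_sc/nm_ge0.
exact: pos_scD.
Qed.

(** Rotating a makes the pairing real and nonnegative; only the self-adjoint part of the rotated
    element then counts, and [npos_le] applies to it. *)
Lemma npos_nm phi a : npos phi ->
  nm (pairing a phi) <= nm a * complex.Re (pairing cone phi).
Proof.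
move=> pp; set z := pairing a phi.
have m0 : 0 <= complex.Re (pairing cone phi).
  by apply: npos_Re_ge0 => //; exact: pos_cone.
have [z0|z0] := eqVneq (nm z) 0; first by rewrite z0 mulr_ge0// nm_ge0.
have z_gt0 : 0 < nm z by rewrite lt_neqAle eq_sym z0 nm_ge0.
pose c : R[i] := conjc z * ((nm z)^-1)%:C.
have c1 : nm c = 1.
  by rewrite nmM nm_real gtr0_norm ?invr_gt0// {1}/nm norm_conjc divff.
have [k [l [kk ll E]]] := re_im_decomp (c *: a).
have -> : nm z = complex.Re (pairing (c *: a) phi).
  rewrite pairingZl -/z /c mulrAC nm_conjc -rmorphM/=.
  by rewrite expr2 mulfK.
rewrite E pairingDl pairingZl raddfD/= Re_iM npos_Im0// subr0.
rewrite (le_trans (npos_le pp kk))// ler_wpM2r//.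
by rewrite (le_trans (nm_re_le kk ll))// -E nmZ c1 mul1r.
Qed.

Lemma npos_unit phi : npos phi ->
  pairing cone phi = (complex.Re (pairing cone phi))%:C.
Proof.
move=> pp; have := npos_Im0 pp (@star1 R A).
by case: (pairing _ _) => u v /= ->.
Qed.

Lemma pairing_is_linear phi : linear (fun a => pairing a phi : R[i]^o).
Proof. by move=> c a b; rewrite pairingDZl. Qed.

Lemma pairing_ge0 phi a : npos phi -> positive a -> 0 <= pairing a phi.
Proof. by move=> pp [b ->]; apply/pp/pos_star_mul. Qed.

Definition normal_functional phi (pp : npos phi) : pos_functional A :=
  PosFunctional (pairing_is_linear phi) (fun a => @pairing_ge0 phi a pp).

Lemma normal_state phi (pp : npos phi) :
  complex.Re (pairing cone phi) = 1 -> is_state (normal_functional pp).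
Proof.
move=> p1; split => // [a|c c0 hc].
  by rewrite mul1r !nmE lecR (le_trans (npos_nm a pp))// p1 mulr1.
have := hc (cone : A); rewrite /= npos_unit// p1 normr1 => /le_trans; apply.
by rewrite ler_piMr// nmE lecR nm_one.
Qed.

Lemma nm_gns_map (E : hilbertModType A) phi (pp : npos phi) (x y : E) :
  nm (gns_map (normal_functional pp) x - gns_map (normal_functional pp) y) ^+ 2
  = sqn phi (x - y).
Proof.
rewrite nm_dot /gns_map -scaleN1r -to_completionZ -to_completionD scaleN1r.
by rewrite to_completion_dot.
Qed.

End NormalState.

Theorem theorem3p6 (R : realType) (A : wstarType R) (E : hilbertModType A)
    (L : set E) :
  self_dual E -> is_submodule L -> closed L ->
  @interior (weak_star E) (~` L) !=set0 ->
  exists omega : pos_functional A,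
    [/\ is_normal omega, is_state omega,
      ~ dense (gns_map omega @` L) &
      orthogonal_complement (gns_map omega @` L) <> [set 0]].
Proof.
move=> _ [L0 LD LZ _] _ [x0 /weak_star_nbhs[phi [e [pp e0 far]]]].
pose m := complex.Re (pairing cone phi).
have m_gt0 : 0 < m.
  (* If phi vanished at 1, the seminorm would be zero and its ball would contain 0, which lies in
     L. *)
  rewrite lt_neqAle; apply/andP; split; last first.
    by apply: npos_Re_ge0 => //; exact: pos_cone.
  apply/eqP => m0; apply: (far 0) => //; apply: le_lt_trans e0.
  rewrite /sqn (le_trans (npos_le pp _)) ?star_inner//.
  by rewrite -/m -m0 mulr0.
have ppm : npos ((m^-1)%:C *: phi) by apply: nposZ => //; rewrite invr_ge0 ltW.
pose omega := normal_functional ppm.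
have om1 : complex.Re (pairing cone ((m^-1)%:C *: phi)) = 1.
  by rewrite pairingZr Re_realM -/m mulVf// gt_eqF.
(* Dividing phi by m turns the bound e on the squared seminorm into e / m. *)
pose d := Num.sqrt (e / m).
have d0 : 0 < d by rewrite sqrtr_gt0 divr_gt0.
have dist l : L l -> d <= nm (gns_map omega x0 - gns_map omega l).
  move=> Ll; rewrite -(@ler_pXn2r _ 2)// ?nnegrE ?nm_ge0 ?(ltW d0)//.
  rewrite sqr_sqrtr; last by rewrite divr_ge0 ?(ltW e0)// ltW.
  rewrite nm_gns_map -sqnN opprB /sqn pairingZr Re_realM mulrC ler_pM2l ?invr_gt0//.
  by rewrite leNgt; apply/negP => /far; exact.
exists omega; split.
- by exists ((m^-1)%:C *: phi).
- exact: normal_state.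
- move=> /(_ (ball (gns_map omega x0) d%:C)) h.
  have [||y [yB [l Ll ly]]] := h.
  + by exists (gns_map omega x0); apply: ballxx; rewrite ltcR.
  + by apply: ball_open; rewrite ltcR.
  + move: yB; rewrite -ly -ball_normE/= nmE ltcR ltNge.
    by rewrite dist.
- apply: (@orthogonal_complement_neq0 _ _ _ (gns_map omega x0) d) => //.
  + exists 0 => //; rewrite /gns_map -[0 in LHS](scale0r (0 : E)) to_completionZ.
    by rewrite scale0r.
  + move=> _ _ [x Lx <-] [z Lz <-]; exists (x + z); first exact: LD.
    by rewrite /gns_map to_completionD.
  + move=> c _ [x Lx <-]; exists (c *: x); first exact: LZ.
    by rewrite /gns_map to_completionZ.
  + by move=> _ [l Ll <-]; exact: dist.
Qed.
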